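(* Let $m\ge 3$ be an odd integer and let $A\subseteq\{2,3,4,\dots\}$ be a set of odd integers such that for any $p,q\in A$ with $p,q\ge m$, neither $p+q+1$ nor $p+q-1$ belongs to $A$. For any integer $n>3$, every graph $G\in\mathcal{G}(A)$ with $\alpha_l(G)<n$ satisfies $\operatorname{def}(G)\le m(n-3)(n-2)^{\frac{m-3}{2}}+1$. Furthermore, when $m=3$, every such $G$ satisfies $\operatorname{def}(G)\le 2n-5$.
   Context: All graphs are finite and simple. The deficiency $\operatorname{def}(G)$ of a graph $G$ is the number of vertices not saturated by a maximum matching of $G$. The local independence number $\alpha_l(G)$ is the largest integer $t$ such that $G$ contains an induced subgraph isomorphic to the star $K_{1,t}$. For $i\ge 2$, $P_i$ denotes the path with $i$ vertices, and the bone $B_i$ is the tree obtained from $P_i$ by attaching two pendent edges (edges to new degree-one vertices) to each of the two end vertices of $P_i$. For a set $A\subseteq\{2,3,4,\dots\}$, $\mathcal{G}(A)$ denotes the family of connected graphs $G$ such that every induced subgraph of $G$ isomorphic to some bone $B_i$ has $i\in A$. *)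

(* Defs.v *)
From HB Require Import structures.
From mathcomp Require Import all_boot.

Set Implicit Arguments.
Unset Strict Implicit.
Unset Printing Implicit Defensive.

Record sgraph := SGraph {
  vertex :> finType;
  adj : rel vertex;
  adj_sym : symmetric adj;
  adj_irrefl : irreflexive adj }.

Definition connected (G : sgraph) : Prop :=
  0 < #|G| /\ forall x y : G, connect (@adj G) x y.

(* An embedding reflecting adjacency in both directions is an isomorphism of H
   onto the subgraph of G induced by the image. *)
Definition contains_induced (G H : sgraph) : bool :=
  [exists f : {ffun H -> G},
     injectiveb f && [forall x, forall y, adj (f x) (f y) == adj x y]].

(* The star K_{1,t}: None is the centre, Some j are the leaves. *)
Definition star_adj t : rel (option 'I_t) := fun x y => isSome x != isSome y.
Arguments star_adj : clear implicits.

Fact star_adj_sym t : symmetric (star_adj t).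
Proof. by move=> x y; rewrite /star_adj eq_sym. Qed.

Fact star_adj_irrefl t : irreflexive (star_adj t).
Proof. by move=> x; rewrite /star_adj eqxx. Qed.

Definition star t : sgraph := SGraph (@star_adj_sym t) (@star_adj_irrefl t).

(* The bone B_i, meaningful for 2 <= i: inl j is the j-th vertex of P_i and
   inr (s, b), b : bool, are the two pendent vertices attached to the first
   (s = false) or the last (s = true) vertex of P_i. *)
Definition bone_adj i : rel ('I_i + bool * bool) := fun x y =>
  match x, y with
  | inl j, inl k => (j.+1 == k :> nat) || (k.+1 == j :> nat)
  | inl j, inr (s, _) | inr (s, _), inl j => j == (if s then i.-1 else 0) :> nat
  | inr _, inr _ => false
  end.
Arguments bone_adj : clear implicits.

Fact bone_adj_sym i : symmetric (bone_adj i).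
Proof. by move=> [j|[s b]] [k|[u c]] //=; rewrite orbC. Qed.

Fact bone_adj_irrefl i : irreflexive (bone_adj i).
Proof. by move=> [j|[s b]] //=; rewrite orbb gtn_eqF. Qed.

Definition bone i : sgraph := SGraph (@bone_adj_sym i) (@bone_adj_irrefl i).

(* The range t < #|G| loses nothing: K_{1,t} has t + 1 vertices, cf. leq_alpha_l. *)
Definition alpha_l (G : sgraph) : nat :=
  \max_(t < #|G| | contains_induced G (star t)) t.

Lemma leq_alpha_l (G : sgraph) t : contains_induced G (star t) -> t <= alpha_l G.
Proof.
move=> Gt; have ltG : t < #|G|.
  have /existsP[f /andP[/injectiveP f_inj _]] := Gt.
  by have := leq_card f f_inj; rewrite card_option card_ord.
exact: (@leq_bigmax_cond _ _ (fun u : 'I_#|G| => nat_of_ord u) (Ordinal ltG)).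
Qed.

Lemma alpha_l_attained (G : sgraph) :
  0 < #|G| -> contains_induced G (star (alpha_l G)).
Proof.
move=> G_gt0; have star0 : contains_induced G (star (Ordinal G_gt0)).
  have /card_gt0P[x _] := G_gt0.
  apply/existsP; exists [ffun _ => x]; apply/andP; split.
    by apply/injectiveP => [[[]//|] [[]//|]].
  by apply/forallP => [[[]//|]]; apply/forallP => [[[]//|]]; rewrite !ffunE !adj_irrefl.
rewrite /alpha_l (bigmax_eq_arg (Ordinal G_gt0)) //.
by case: arg_maxnP.
Qed.

Definition edges (G : sgraph) : {set {set G}} :=
  [set [set p.1; p.2] | p : G * G & adj p.1 p.2].

Definition matching (G : sgraph) (M : {set {set G}}) : bool :=
  (M \subset edges G) && trivIset M.

Definition max_matching (G : sgraph) : {set {set G}} :=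
  [arg max_(M > set0 | matching M) #|M|].

Lemma matching0 (G : sgraph) : matching (set0 : {set {set G}}).
Proof. by rewrite /matching sub0set; apply/trivIsetP => B C; rewrite inE. Qed.

Lemma max_matchingP (G : sgraph) :
  matching (max_matching G) /\
  forall M : {set {set G}}, matching M -> #|M| <= #|max_matching G|.
Proof. by rewrite /max_matching; case: arg_maxnP => [|M]; first exact: matching0. Qed.

(* All maximum matchings saturate the same number of vertices, so the choice
   made by max_matching is irrelevant. *)
Definition deficiency (G : sgraph) : nat := #|~: cover (max_matching G)|.

Definition bone_family (A : nat -> Prop) (G : sgraph) : Prop :=
  connected G /\ forall i, 2 <= i -> contains_induced G (bone i) -> A i.

(* Main.v *)
(* If removing the ends of some edge leaves G connected (or empty), that edge can be put
   in a matching and we induct. Otherwise the end of a longest path gives a vertex x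
   with two leaves. Layer G by the distance from x and match greedily from the deepest
   layer upwards: a vertex w with a set R(w) of r >= 2 independent unmatched children
   costs r - 1 <= n - 3 unmatched vertices, and together with the leaves at x it ends a
   bone, so such a branching vertex lies in an even layer. Two monotone paths climbing
   from two branching vertices cannot be joined by an edge, by parity, so they meet in a
   vertex, which is in turn the end of a bone towards x and towards both of them.

   Write m = 2k + 3. If bones with paths of lengths d, e > 2k occur, then none with a
   path of length d + e or d + e + 2 does. Hence two branching vertices in one layer
   beyond 2k meet at most 2k layers above it, so that such a layer has at most (n-2)^k
   of them, while a layer 2h with 0 < h <= k has at most (n-3)(n-2)^(h-1). The layers
   beyond 2k containing branching vertices lie in [2k+2, 4k] or within 2k+2 of the
   deepest one. Together with x there are at most m(n-2)^k branching vertices. For k = 0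
   at most two of them differ from x, and their unmatched children are all adjacent to
   the deeper one, so they cost at most n - 3 altogether. *)
From mathcomp Require Import all_boot.
From mathcomp Require Import zify.
Require Import Defs.

Set Implicit Arguments.
Unset Strict Implicit.
Unset Printing Implicit Defensive.

(** * Matchings with few unmatched vertices *)

(** A certificate that [B] splits into disjoint edges and at most [u] single vertices, assembled
    piece by piece instead of as a set of edges. The arbitrary [u] in [missing0] allows the bound to
    be weakened. *)
Inductive missing_at_most (G : sgraph) : {set G} -> nat -> Prop :=
| missing0 u : missing_at_most set0 u
| missing_vertex (B : {set G}) u v :
    v \notin B -> missing_at_most B u -> missing_at_most (v |: B) u.+1
| missing_edge (B : {set G}) u v w :
    adj v w -> v \notin B -> w \notin B -> missing_at_most B u ->
    missing_at_most (v |: (w |: B)) u.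

Lemma adj_neq (G : sgraph) (v w : G) : adj v w -> v != w.
Proof. by move=> vw; apply/eqP => eq_vw; rewrite eq_vw adj_irrefl in vw. Qed.

Lemma missing_leq (G : sgraph) (B : {set G}) u u' :
  missing_at_most B u -> u <= u' -> missing_at_most B u'.
Proof.
move=> nmB; elim: nmB u' => [a u' _|{}B {}u v vB _ IH [//|u'] le_u|
                            {}B {}u v w vw vB wB _ IH u' le_u].
- exact: missing0.
- by apply: missing_vertex => //; apply: IH.
- by apply: missing_edge => //; apply: IH.
Qed.

Lemma missing_union (G : sgraph) (B C : {set G}) u u' :
  missing_at_most B u -> missing_at_most C u' -> [disjoint B & C] ->
  missing_at_most (B :|: C) (u + u').
Proof.
move=> nmB nmC; elim: nmB => [a _|{}B {}u v vB _ IH|{}B {}u v w vw vB wB _ IH].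
- by rewrite set0U; apply: missing_leq nmC _; rewrite leq_addl.
- rewrite disjoints_subset subUset sub1set inE => /andP[vC BC].
  rewrite -setUA addSn; apply: missing_vertex.
    by rewrite inE negb_or vB.
  by apply: IH; rewrite disjoints_subset.
- rewrite disjoints_subset !subUset !sub1set !inE => /and3P[vC wC BC].
  rewrite -!setUA; apply: missing_edge; rewrite // ?inE ?negb_or ?vB ?wB //.
  by apply: IH; rewrite disjoints_subset.
Qed.

Lemma missing_card (G : sgraph) (B : {set G}) : missing_at_most B #|B|.
Proof.
elim: {B}_.+1 {-2}B (ltnSn #|B|) => // k IH B ltB.
have [->|[v vB]] := set_0Vmem B; first exact: missing0.
rewrite (cardsD1 v) vB -{1}(setD1K vB); apply: missing_vertex; first by rewrite !inE eqxx.
by apply: IH; rewrite (cardsD1 v B) vB in ltB.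
Qed.

Lemma missing_star (G : sgraph) (R : {set G}) w :
  0 < #|R| -> (forall v, v \in R -> adj w v) ->
  missing_at_most (w |: R) #|R|.-1.
Proof.
move=> /card_gt0P[v vR] wR; rewrite (cardsD1 v) vR -{1}(setD1K vR).
apply: missing_edge; [exact: wR| |by rewrite !inE eqxx|exact: missing_card].
by rewrite !inE; apply/nandP; right; apply/negP => /wR; rewrite adj_irrefl.
Qed.

Lemma missing_matching (G : sgraph) (B : {set G}) u : missing_at_most B u ->
  exists2 M, matching M & (cover M \subset B) && (#|B :\: cover M| <= u).
Proof.
elim=> [a|{}B {}u v vB _ [M Mm /andP[MB le_u]]|
        {}B {}u v w vw vB wB _ [M Mm /andP[MB le_u]]].
- by exists set0; rewrite ?matching0 // /cover big_set0 sub0set set0D cards0.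
- exists M => //; rewrite (subset_trans MB) ?subsetUr //=.
  rewrite setDUl; apply: leq_trans (leq_card_setU _ _) _.
  rewrite -add1n leq_add //.
  by rewrite -(cards1 v) subset_leq_card // subDset subsetUr.
- exists ([set v; w] |: M).
    case/andP: Mm => Me Mt; apply/andP; split.
      rewrite subUset Me andbT sub1set; apply/imsetP; exists (v, w) => //.
      by rewrite inE.
    have vwM : [disjoint [set v; w] & cover M].
      rewrite disjoints_subset subUset !sub1set !inE.
      by apply/andP; split; apply/negP => /(subsetP MB); apply/negP.
    apply/trivIsetP => C D; rewrite !inE.
    have M1 E : E \in M -> [disjoint [set v; w] & E].
      by move=> EM; apply: disjointWr vwM; apply: bigcup_sup.
    case/predU1P => [->|CM] /predU1P[->|DM] neq; first by rewrite eqxx in neq.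
    - exact: M1.
    - by rewrite disjoint_sym; apply: M1.
    - by move/trivIsetP: Mt; apply.
  have -> : cover ([set v; w] |: M) = [set v; w] :|: cover M.
    apply/setP => z; apply/bigcupP/setUP.
      case=> E /setU1P[->|EM] zE; first by left.
      by right; apply/bigcupP; exists E.
    case=> [zvw|/bigcupP[E EM zE]]; first by exists [set v; w]; rewrite ?setU11.
    by exists E => //; rewrite inE EM orbT.
  apply/andP; split; first by rewrite setUA setUS.
  apply: leq_trans le_u; apply: subset_leq_card.
  apply/subsetP => z; rewrite !in_setD !in_setU !in_set1.
  by case: (z == v) => /=; case: (z == w) => /=; rewrite ?andbF.
Qed.

Lemma cover_matching_card (G : sgraph) (M : {set {set G}}) :
  matching M -> #|cover M| = #|M| * 2.
Proof.
case/andP => Me /eqP <-; rewrite -sum_nat_const; apply: eq_bigr => C CM.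
have /imsetP[[v w]] := subsetP Me C CM; rewrite inE /= => vw ->.
by rewrite cards2 (adj_neq vw).
Qed.

Lemma deficiency_leq (G : sgraph) u :
  missing_at_most [set: G] u -> deficiency G <= u.
Proof.
case/missing_matching => M Mm /andP[_ le_u]; rewrite setTD in le_u.
have [maxm leM] := max_matchingP G.
apply: leq_trans le_u; rewrite /deficiency [leqLHS]cardsCs [leqRHS]cardsCs.
  rewrite !setCK !cover_matching_card //.
by rewrite leq_sub2l // leq_mul2r leM.
Qed.

(** * Induced subgraphs *)

Definition adj_in (G : sgraph) (B : {set G}) : rel G :=
  fun a b => [&& adj a b, a \in B & b \in B].

Section InducedSubgraph.

Variables (G : sgraph) (B : {set G}).

Definition induced_adj : rel {v : G | v \in B} := relpre val (@adj G).

Fact induced_adj_sym : symmetric induced_adj.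
Proof. by move=> v w; apply: adj_sym. Qed.

Fact induced_adj_irrefl : irreflexive induced_adj.
Proof. by move=> v; apply: adj_irrefl. Qed.

Definition induced := SGraph induced_adj_sym induced_adj_irrefl.

Lemma contains_induced_induced H : contains_induced induced H -> contains_induced G H.
Proof.
case/existsP => f /andP[/injectiveP f_inj /forallP f_adj].
apply/existsP; exists [ffun x => val (f x)]; apply/andP; split.
  by apply/injectiveP => x y; rewrite !ffunE => /val_inj/f_inj.
by apply/forallP => x; apply/forallP => y; rewrite !ffunE; apply: (forallP (f_adj x)).
Qed.

Lemma missing_induced (C : {set induced}) u :
  missing_at_most C u -> missing_at_most [set val v | v in C] u.
Proof.
have val_in (D : {set induced}) v : (val v \in [set val v | v in D]) = (v \in D).
  by apply: mem_imset; apply: val_inj.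
elim=> [a|{}C {}u v vC _ IH|{}C {}u v w vw vC wC _ IH].
- by rewrite imset0; apply: missing0.
- by rewrite imsetU1; apply: missing_vertex; rewrite ?val_in.
- by rewrite !imsetU1; apply: missing_edge; rewrite ?val_in.
Qed.

Lemma imset_val_induced : [set val v | v in [set: induced]] = B.
Proof.
apply/setP => v; apply/imsetP/idP => [[w _ ->]|vB]; first exact: (valP w).
by exists (Sub v vB).
Qed.

Lemma card_induced : #|induced| = #|B|.
Proof. by rewrite /= card_sig; apply: eq_card => v; rewrite inE. Qed.

Lemma induced_connect (v w : induced) :
  connect (adj_in B) (val v) (val w) ->
  connect (@adj induced) v w.
Proof.
case/connectP => p; elim: p v => [|a p IH] v /=.
  by move=> _ /val_inj ->; apply: connect0.
case/andP => /and3P[va vB aB] pp pw.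
apply: (@connect_trans _ _ (Sub a aB)); first by apply: connect1.
exact: IH.
Qed.

End InducedSubgraph.

(** * Leaves *)

Section Leaves.

Variable G : sgraph.
Hypothesis G_conn : forall x y : G, connect (@adj G) x y.

Lemma adj_in_sym (B : {set G}) : connect_sym (adj_in B).
Proof.
by apply: sym_connect_sym => a b; rewrite /adj_in adj_sym [(a \in B) && _]andbC.
Qed.

Lemma connect_adj_in (B : {set G}) a b : a \in B -> connect (adj_in B) a b -> b \in B.
Proof.
move=> aB /connectP[p]; elim: p a aB => [|c p IH] a aB /=; first by move=> _ ->.
by case/andP => /and3P[_ _ cB]; apply: IH.
Qed.

Definition leaf_of (x l : G) := adj x l /\ forall y, adj l y -> y = x.

(** The rest [s] of a longest path lies within one component of the graph without [v0] and [v1], so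
    another component avoids [s]. A vertex [z0] of it next to [v0] or [v1] cannot prolong the path
    at [v0], hence it is adjacent to [v1]; a further neighbour [y] would make [y, z0, v1, s] a
    longer path. *)
Lemma longest_path_leaf (v0 v1 : G) s :
  uniq [:: v0, v1 & s] -> path (@adj G) v0 (v1 :: s) ->
  (forall t : seq G, uniq t -> sorted (@adj G) t -> size t <= (size s).+2) ->
  (exists z z', [/\ z \in ~: [set v0; v1], z' \in ~: [set v0; v1] &
     ~~ connect (adj_in (~: [set v0; v1])) z z']) ->
  exists z, [/\ leaf_of v1 z, z \notin [:: v0, v1 & s] & z != v0].
Proof.
set B := ~: _; move=> Us Ps maxs [z [z' [zB z'B nzz']]].
have sB y : y \in s -> y \in B.
  move=> ys; rewrite !inE; move: Us => /= /and3P[]; rewrite inE negb_or.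
  move=> /andP[_ v0s] v1s _; apply/norP; split.
    by apply: contraNneq v0s => <-.
  by apply: contraNneq v1s => <-.
have conn_s y y' : y \in s -> y' \in s -> connect (adj_in B) y y'.
  case: (s) sB Ps => // a s' sB /= /and3P[_ _ Pa] ys y's.
  have PR : path (adj_in B) a s'.
    have : all [in B] (a :: s') by apply/allP.
    elim: s' {sB ys y's} a Pa => //= b s' IH a /andP[ab Pb] /and3P[aB bB s'B].
    by rewrite /adj_in ab aB bB /=; apply: IH; rewrite //= bB.
  by apply: (@connect_trans _ _ a); first rewrite adj_in_sym; apply: path_connect PR _ _.
have {z z' zB z'B nzz'} [z zB nzs] : exists2 z, z \in B &
    forall y, y \in s -> ~~ connect (adj_in B) z y.
  case: (boolP [forall y in s, ~~ connect (adj_in B) z y]) => [/forall_inP|].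
    by exists z.
  rewrite negb_forall_in => /exists_inP[y ys /negPn zy].
  exists z' => // y' y's; apply: contra nzz' => z'y'.
  apply: connect_trans zy _; apply: connect_trans (conn_s _ _ ys y's) _.
  by rewrite adj_in_sym.
have [z0 zz0 z0v] : exists2 z0, connect (adj_in B) z z0 & adj z0 v0 || adj z0 v1.
  apply/exists_inP; apply: contraT; rewrite negb_exists_in => /forall_inP nz.
  have /connectP[p] := G_conn z v1.
  suff: forall a, connect (adj_in B) z a -> path (@adj G) a p -> last a p \in B.
    move=> /(_ z (connect0 _ _)) h /h {h} + eq_v1; rewrite -eq_v1.
    by rewrite !inE eqxx orbT.
  elim: p => [|b p IH] a za /=; first by move=> _; apply: connect_adj_in za.
  have aB := connect_adj_in zB za.
  case/andP => ab; apply: IH; apply: (connect_trans za); apply: connect1; rewrite /adj_in ab aB /=.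
  rewrite in_setC in_set2 negb_or.
  have := nz a za; rewrite negb_or => /andP[/negP av0 /negP av1].
  by apply/andP; split; apply/eqP => eb; [apply: av0 | apply: av1]; rewrite -eb.
have z0B := connect_adj_in zB zz0.
have z0s : z0 \notin s by apply/negP => /nzs; rewrite zz0.
have z0p : z0 \notin [:: v0, v1 & s].
  by move: z0B; rewrite !inE !negb_or z0s andbT.
have nz0 : ~~ adj z0 v0.
  apply/negP => z0v0.
  have : size [:: z0, v0, v1 & s] <= (size s).+2.
    by apply: maxs; [rewrite cons_uniq z0p | rewrite /= z0v0].
  by rewrite /= ltnn.
have z0v1 : adj z0 v1 by case/orP: z0v => // /(negP nz0).
have neq_z0 : z0 != v0 by move: z0p; rewrite inE negb_or => /andP[].
exists z0; split => //; split; first by rewrite adj_sym.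
move=> y z0y; apply/eqP/negPn/negP => yv1.
have yv0 : y != v0 by apply: contraNneq nz0 => <-.
have yB : y \in B by rewrite !inE negb_or yv0.
have ys : y \notin s.
  apply/negP => /nzs/negP; apply; apply: (connect_trans zz0); apply: connect1.
  by rewrite /adj_in z0y z0B.
have : size [:: y, z0, v1 & s] <= (size s).+2.
  apply: maxs.
    move: Us z0p; rewrite /= !inE !negb_or => /and3P[_ -> ->] /and3P[_ -> ->].
    by rewrite yv1 ys !andbT eq_sym adj_neq.
  by move: Ps => /= /andP[_ ->]; rewrite adj_sym z0y z0v1.
by rewrite /= ltnn.
Qed.

Lemma exists_longest_path : 0 < #|G| -> exists s : seq G,
  [/\ uniq s, sorted (@adj G) s, 0 < size s &
   forall t : seq G, uniq t -> sorted (@adj G) t -> size t <= size s].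
Proof.
move=> /card_gt0P[x _].
pose P k := [exists t : k.-tuple G, uniq t && sorted (@adj G) t].
have P1 : P 1 by apply/existsP; exists [tuple x].
have Pub k : P k -> k <= #|G|.
  by case/existsP => t /andP[/card_uniqP + _]; rewrite size_tuple => <-; apply: max_card.
have [k /existsP[t /andP[Ut St]] maxk] := ex_maxnP (ex_intro _ 1 P1) Pub.
exists t; rewrite size_tuple; split => //; first exact: maxk.
by move=> t' Ut' St'; apply: maxk; apply/existsP; exists (in_tuple t'); apply/andP.
Qed.

Lemma exists_two_leaves : 1 < #|G| ->
  (forall u v : G, adj u v -> exists z z', [/\ z \in ~: [set u; v], z' \in ~: [set u; v] &
     ~~ connect (adj_in (~: [set u; v])) z z']) ->
  exists x l l', [/\ leaf_of x l, leaf_of x l' & l != l'].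
Proof.
move=> gt1 irr; have [s [Us Ss _ maxs]] := exists_longest_path (ltnW gt1).
have [x [y neq_xy]] : exists x y : G, x != y.
  by have /card_gt1P[x [y [_ _ ne]]] := gt1; exists x, y.
have [a xa] : exists a, adj x a.
  have /connectP[[|a p] /=] := G_conn x y; first by move=> _ e; rewrite e eqxx in neq_xy.
  by case/andP => xa _ _; exists a.
case: s Us Ss maxs => [|v0 [|v1 s]] Us Ss maxs.
- by have := maxs [:: x] isT isT.
- by have := maxs [:: x; a]; rewrite /= inE adj_neq //= xa => /(_ isT isT).
have v01 : adj v0 v1 by case/andP: Ss.
have [l [ll lp _]] := longest_path_leaf Us Ss maxs (irr _ _ v01).
have lv1 : adj l v1 by rewrite adj_sym; case: ll.
(* Replacing [v0] by the leaf [l] yields another longest path, which provides a leaf at [v1]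
   different from [l]. *)
have Ul : uniq [:: l, v1 & s].
  by move: lp Us; rewrite /= !inE !negb_or => /and3P[_ -> ->] /and3P[_ -> ->].
have Pl : path (@adj G) l (v1 :: s) by move: Ss => /= /andP[_ ->]; rewrite lv1.
have [l' [ll' _ ne]] := longest_path_leaf Ul Pl maxs (irr _ _ lv1).
by exists v1, l', l; split.
Qed.

(** * Layers *)

(** [lev] is the distance from [x]; only these three properties of it enter later arguments. *)
Lemma exists_layers (x : G) : exists lev : G -> nat,
  [/\ forall v, (lev v == 0) = (v == x),
      forall u v, adj u v -> lev v <= (lev u).+1 &
      forall v, 0 < lev v -> exists2 u, adj u v & (lev u).+1 = lev v].
Proof.
pose P v k := [exists t : k.-tuple G, path (@adj G) x t && (last x t == v)].
have exP v : exists k, P v k.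
  have /connectP[p pp ->] := G_conn x v.
  by exists (size p); apply/existsP; exists (in_tuple p); rewrite /= pp eqxx.
pose lev v := ex_minn (exP v).
have levP v p : path (@adj G) x p -> last x p = v -> lev v <= size p.
  move=> pp lp; rewrite /lev; case: ex_minnP => k _; apply.
  by apply/existsP; exists (in_tuple p); rewrite /= pp lp eqxx.
have levE v : exists p, [/\ path (@adj G) x p, last x p = v & size p = lev v].
  rewrite {}/lev in levP *; case: ex_minnP => k /existsP[t /andP[pt /eqP lt]] _.
  by exists t; rewrite size_tuple.
have lev_adj u v : adj u v -> lev v <= (lev u).+1.
  move=> uv; have [p [pp lp <-]] := levE u.
  by rewrite -(size_rcons p v); apply: levP; rewrite ?last_rcons // rcons_path pp lp.
exists lev; split=> // [v|v].
  apply/eqP/eqP => [|->]; last by apply/eqP; rewrite -leqn0; apply: (levP _ [::]).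
  by have [[|a p] [_ <- sp]] := levE v => // lev0; rewrite lev0 in sp.
have [p [pp lp sp]] := levE v; rewrite -sp.
elim/last_ind: p pp lp sp => // p w _; rewrite rcons_path last_rcons => /andP[pp lw] ew sp _.
subst w; exists (last x p) => //.
rewrite size_rcons in sp *; congr _.+1; apply/eqP; rewrite eqn_leq levP //=.
by rewrite -ltnS sp lev_adj.
Qed.

End Leaves.

(** * Greedy matching of one layer into the layer above *)

Section Greedy.

Variable G : sgraph.
Implicit Types (X P C W : {set G}) (R : G -> {set G}).

Definition nbrs (w : G) := [set v | adj w v].

(** The third condition excludes all neighbours of [w'], not only [R w']: a bone joining [w] and
    [w'] needs two pendant vertices at each end that are not adjacent to the other end. *)
Definition branching W R := [/\
  forall w, w \in W -> 1 < #|R w| /\ (forall v, v \in R w -> adj w v),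
  forall w w' a b, w \in W -> w' \in W -> a \in R w -> b \in R w' -> ~~ adj a b &
  forall w w', w \in W -> w' \in W -> w != w' -> 1 < #|R w :\: nbrs w'|].

(* Choosing the vertex of [P] with most neighbours left guarantees that of two
   chosen vertices the earlier one also has two neighbours of its own. *)
Lemma greedy_matching X P : [disjoint X & P] ->
  (forall v, v \in X -> exists2 w, w \in P & adj w v) ->
  exists C W R, [/\ W \subset C /\ C \subset P, branching W R,
    forall w, w \in W -> R w \subset X &
    missing_at_most (X :|: C) (\sum_(w in W) (#|R w|).-1)].
Proof.
elim: {X}_.+1 {-2}X (ltnSn #|X|) P => // N IH X ltX P XP XN.
have [->|[v0 v0X]] := set_0Vmem X.
  exists set0, set0, (fun=> set0); split; rewrite ?sub0set //.
  - by split=> w; [|move=> w' a b|move=> w']; rewrite in_set0.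
  - by rewrite setU0; apply: missing0.
have notP v : v \in X -> v \notin P.
  by move=> vX; apply: contraTN XP => vP; apply/pred0Pn; exists v; rewrite /= vX.
(* Edges inside [X] are matched first, so that afterwards [X] is independent. *)
have [/exists_inP[a aX /exists_inP[b bX ab]]|indepX] :=
    boolP [exists a in X, [exists b in X, adj a b]].
  have neq_ab := adj_neq ab.
  have [|||C [W [R [[WC CP] WR RX nm]]]] := IH (X :\ a :\ b) _ P.
  - by move: ltX; rewrite (cardsD1 a) aX (cardsD1 b) !inE bX eq_sym neq_ab /=; clear; lia.
  - by apply: disjointWl XP; apply: subset_trans (subD1set _ _) (subD1set _ _).
  - by move=> v; rewrite !inE => /and3P[_ _ /XN].
  exists C, W, R; split=> //.
    move=> w /RX/subset_trans; apply.
    exact: subset_trans (subD1set _ _) (subD1set _ _).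
  have -> : X :|: C = b |: (a |: (X :\ a :\ b :|: C)).
    apply/setP => v; rewrite !inE.
    case: (eqVneq v b) => [->|_] /=; first by rewrite bX.
    by case: (eqVneq v a) => [->|_] /=; first by rewrite aX.
  have aC : a \notin C by apply: contra (notP a aX) => /(subsetP CP).
  have bC : b \notin C by apply: contra (notP b bX) => /(subsetP CP).
  by apply: missing_edge; rewrite // 1?adj_sym // !inE ?eqxx ?negb_or ?andbF.
have {}indepX a b : a \in X -> b \in X -> ~~ adj a b.
  move=> aX bX; apply: contra indepX => ab.
  by apply/exists_inP; exists a => //; apply/exists_inP; exists b.
have [w0 w0P w0v0] := XN v0 v0X.
pose f w := #|X :&: nbrs w|.
have [w wP maxw] : exists2 w, w \in P & forall w', w' \in P -> f w' <= f w.
  by case: (@arg_maxnP _ w0 [in P] f w0P) => w wP maxw; exists w.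
set R0 := X :&: nbrs w.
have R0_gt0 : 0 < #|R0|.
  apply: leq_trans (maxw w0 w0P); apply/card_gt0P; exists v0.
  by rewrite !inE v0X.
have wR0 v : v \in R0 -> adj w v by rewrite !inE => /andP[].
have R0X : R0 \subset X by apply: subsetIl.
have [|||C [W [R [[WC CP] [WR Wind Wsep] RX nm]]]] := IH (X :\: R0) _ (P :\ w).
- have := cardsID R0 X; rewrite (setIidPr R0X); move: ltX R0_gt0; clear; lia.
- by apply: disjointWl (disjointWr _ XP); rewrite ?subD1set ?subsetDl.
- move=> v; rewrite !inE => /andP[+ vX]; rewrite vX /= => nwv.
  have [w' w'P w'v] := XN v vX; exists w' => //; rewrite !inE w'P andbT.
  by apply: contraNneq nwv => <-.
have wC : w \notin C by apply/negP => /(subsetP CP); rewrite !inE eqxx.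
have wW : w \notin W by apply: contra wC => /(subsetP WC).
have wX : w \notin X by apply: contraL wP => /notP.
have CP' : w |: C \subset P.
  by rewrite subUset sub1set wP (subset_trans CP) ?subD1set.
have RX' z : z \in W -> R z \subset X.
  by move/RX/subset_trans; apply; apply: subsetDl.
have nm' : missing_at_most (X :|: (w |: C)) ((#|R0|).-1 + \sum_(w in W) (#|R w|).-1).
  have -> : X :|: (w |: C) = (w |: R0) :|: (X :\: R0 :|: C).
    apply/setP => v; rewrite in_setU in_setU1 [in RHS]in_setU in_setU1.
    rewrite [v \in _ :|: C]in_setU in_setD; have [->|_] := eqVneq v w; first by rewrite orbT.
    by have := subsetP R0X v; case: (v \in R0) => //= ->.
  apply: missing_union nm _; first exact: missing_star.
  apply/pred0P => v /=; rewrite in_setU1 in_setU in_setD.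
  apply/negP => /andP[/predU1P[->|vR0]]; first by rewrite (negbTE wX) (negbTE wC) andbF.
  rewrite vR0 /= => /(subsetP CP); rewrite !inE => /andP[_].
  by apply/negP/notP/(subsetP R0X).
(* With a single neighbour left, [w] is matched at no cost and is not recorded as branching. *)
case: (leqP #|R0| 1) => [R0_le1|R0_gt1].
  exists (w |: C), W, R; split=> //.
    by split=> //; apply: subset_trans WC (subsetUr _ _).
  by apply: missing_leq nm' _; case: #|R0| R0_le1 => [|[]].
pose R' z := if z == w then R0 else R z.
have R'w : R' w = R0 by rewrite /R' eqxx.
have R'W z : z \in W -> R' z = R z.
  by move=> zW; rewrite /R' ifF //; apply/negP => /eqP e; rewrite -e zW in wW.
have R'X z : z \in w |: W -> R' z \subset X.
  by case/setU1P => [->|zW]; rewrite ?R'w // R'W // RX'.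
exists (w |: C), (w |: W), R'; split=> //.
- by split=> //; apply: setUS.
- have private z : z \in W -> R z :\: nbrs w = R z.
    move=> zW; apply/setP => v; rewrite !inE; case: (boolP (v \in R z)) => [|_]; last first.
      by rewrite andbF.
    by move/(subsetP (RX z zW)); rewrite !inE => /andP[+ vX]; rewrite vX => ->.
  split=> [z|z z' a b zW z'W aR bR|z z'].
  + by case/setU1P => [->|zW]; rewrite ?R'w ?R'W //; apply: WR.
  + by apply: indepX; [apply: (subsetP (R'X z zW))|apply: (subsetP (R'X z' z'W))].
  + case/setU1P => [->|zW]; case/setU1P => [->|z'W]; rewrite ?eqxx // ?R'w ?R'W // => ne.
    (* By the choice of [w], [R0] is at least as large as [X :&: nbrs z'], which contains the
       disjoint sets [R z'] and [R0 :&: nbrs z']. Hence at least [#|R z'|] vertices of [R0] lie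
       outside [nbrs z']. *)
    * have [gt1 z'R] := WR z' z'W; apply: leq_trans gt1 _.
      have z'P : z' \in P.
        by move/(subsetP WC)/(subsetP CP): z'W; rewrite !inE => /andP[].
      have := maxw z' z'P; rewrite /f -/R0.
      have sub : R z' :|: (R0 :&: nbrs z') \subset X :&: nbrs z'.
        rewrite subUset setSI // andbT subsetI RX' //.
        by apply/subsetP => v /z'R; rewrite inE.
      have disj : R z' :&: (R0 :&: nbrs z') = set0.
        apply/setP => v; rewrite in_set0; apply/negP => /setIP[vR /setIP[vR0 _]].
        by have := subsetP (RX z' z'W) v vR; rewrite in_setD vR0.
      have := subset_leq_card sub; rewrite cardsU disj cards0 subn0.
      have := cardsID (nbrs z') R0; clear; lia.
    * by rewrite private //; case: (WR z zW).
    * exact: Wsep.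
- rewrite big_setU1 //= R'w (eq_bigr (fun z => (#|R z|).-1)) // => z zW.
  by rewrite R'W.
Qed.

End Greedy.

(** * Stars and bones *)

(** Distinctness is included so that a map respecting [adj] and [anti] on distinct vertices is
    automatically injective. *)
Definition anti (G : sgraph) : rel G := fun u v => (u != v) && ~~ adj u v.

Lemma anti_sym (G : sgraph) (u v : G) : anti u v = anti v u.
Proof. by rewrite /anti eq_sym adj_sym. Qed.

Lemma contains_inducedP (G H : sgraph) (f : H -> G) :
  (forall x y, x != y -> if adj x y then adj (f x) (f y) else anti (f x) (f y)) ->
  contains_induced G H.
Proof.
move=> f_adj; apply/existsP; exists [ffun x => f x]; apply/andP; split.
  apply/injectiveP => x y; rewrite !ffunE => fxy; apply/eqP/negPn/negP => /f_adj.
  by rewrite fxy /anti eqxx adj_irrefl; case: ifP.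
apply/forallP => x; apply/forallP => y; rewrite !ffunE.
have [->|/f_adj] := eqVneq x y; first by rewrite !adj_irrefl.
by case: ifP => _ => [->|/andP[_ /negbTE->]].
Qed.

Lemma contains_star (G : sgraph) (v : G) (I : {set G}) :
  (forall a, a \in I -> adj v a) -> (forall a b, a \in I -> b \in I -> ~~ adj a b) ->
  contains_induced G (star #|I|).
Proof.
move=> vI indepI.
apply: (@contains_inducedP _ (star #|I|)
  (fun o : option 'I_#|I| => if o is Some i then enum_val i else v)).
move=> [i|] [j|] //= neq; rewrite /star_adj /=.
- rewrite /anti indepI ?enum_valP // andbT.
  by apply: contra neq => /eqP/enum_val_inj ->.
- by rewrite adj_sym vI // enum_valP.
- by rewrite vI // enum_valP.
Qed.

(** The path is a function on [nat] constrained only up to [k], so that it can be glued from pieces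
    by arithmetic on the index. Here [k] counts edges, whence [k.+1] in the bone. *)
Lemma contains_bone (G : sgraph) (k : nat) (p : nat -> G) (q : bool -> bool -> G) :
  0 < k ->
  (forall s t, s < t <= k -> if t == s.+1 then adj (p s) (p t) else anti (p s) (p t)) ->
  (forall e b t, t <= k ->
     if t == (if e then k else 0) then adj (q e b) (p t) else anti (q e b) (p t)) ->
  (forall e b e' b', (e, b) != (e', b') -> anti (q e b) (q e' b')) ->
  contains_induced G (bone k.+1).
Proof.
move=> k_gt0 pP qP qq.
pose f (v : 'I_k.+1 + bool * bool) := match v with inl j => p j | inr (e, b) => q e b end.
apply: (@contains_inducedP _ (bone k.+1) f) => -[i|[e b]] [j|[e' b']] neq /=.
- have neq_ij : i != j :> nat by apply: contra neq => /eqP/val_inj ->.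
  wlog lt_ij : i j neq neq_ij / i < j.
    move=> IH; have [lt_ij|lt_ji|eq_ij] := ltngtP i j; first exact: IH.
      by rewrite orbC adj_sym anti_sym IH // eq_sym.
    by rewrite eq_ij eqxx in neq_ij.
  have := pP i j; rewrite lt_ij -ltnS ltn_ord => /(_ isT).
  by rewrite eq_sym [j.+1 == _]gtn_eqF ?orbF // ltnS ltnW.
- have := qP e' b' i; rewrite -ltnS ltn_ord => /(_ isT).
  by rewrite adj_sym anti_sym; case: (e').
- have := qP e b j; rewrite -ltnS ltn_ord => /(_ isT).
  by case: (e).
- exact: qq.
Qed.

(* [lia] splits on every Boolean hypothesis, so adjacency facts are cleared first. *)
Ltac nlia :=
  repeat match goal with
  | H : context [@adj] |- _ => clear H
  | H : context [@anti] |- _ => clear H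
  | H : context [@in_mem] |- _ => clear H
  end; lia.

(** * Bones in a layered graph *)

Section Layered.

Variables (G : sgraph) (lev : G -> nat) (x l l' : G) (A : nat -> Prop).
Hypothesis lev_eq0 : forall v, (lev v == 0) = (v == x).
Hypothesis lev_adj : forall u v, adj u v -> lev v <= (lev u).+1.
Hypothesis lev_parent : forall v, 0 < lev v -> exists2 u, adj u v & (lev u).+1 = lev v.
Hypotheses (xl : leaf_of x l) (xl' : leaf_of x l') (neq_l : l != l').
Hypothesis bone_A : forall i, 2 <= i -> contains_induced G (bone i) -> A i.
Hypothesis A_odd : forall i, A i -> odd i.

Lemma anti_far u v : (lev u).+2 <= lev v -> anti u v.
Proof.
move=> le_uv; apply/andP; split; first by apply: contraTneq le_uv => ->; nlia.
by apply: contraL le_uv => /lev_adj; nlia.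
Qed.

Lemma lev_root : lev x = 0.
Proof. by apply/eqP; rewrite lev_eq0. Qed.

Lemma anti_leaf y v u : leaf_of x y -> v != x -> adj v u -> u != x -> anti y v.
Proof.
move=> [xy yP] vx vu ux; apply/andP; split.
  by apply: contraNneq ux => yv; rewrite -yv in vu; apply/eqP/yP.
by apply: contra vx => /yP->.
Qed.

Lemma anti_leaf_lev y v : leaf_of x y -> 1 < lev v -> anti y v.
Proof.
move=> yl lv; have [u uv lu] : exists2 u, adj u v & (lev u).+1 = lev v.
  by apply: lev_parent; nlia.
apply: (@anti_leaf y v u) => //; rewrite -?lev_eq0 -?lt0n; try nlia.
by rewrite adj_sym.
Qed.

Lemma anti_leaves : anti l l'.
Proof.
rewrite /anti neq_l; apply/negP => ll'; have := xl.2 _ ll'.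
by move/eqP; rewrite eq_sym -[_ == _]negbK adj_neq //; case: xl'.
Qed.

(** * Legs: paths with one vertex in each layer, indexed by the layer *)

Definition leg (g : nat -> G) a b :=
  forall t, a <= t <= b -> lev (g t) = t /\ (t < b -> adj (g t) (g t.+1)).

Lemma leg_lev g a b t : leg g a b -> a <= t <= b -> lev (g t) = t.
Proof. by move=> gP tP; case: (gP t tP). Qed.

Lemma leg_adj g a b t : leg g a b -> a <= t < b -> adj (g t) (g t.+1).
Proof. by move=> gP tP; case: (gP t) => [|_ ->] //; nlia. Qed.

(** Non-consecutive vertices of a leg are at least two layers apart, so a leg is always an induced
    path. *)
Lemma leg_induced g a b s t : leg g a b -> a <= s -> s < t <= b ->
  if t == s.+1 then adj (g s) (g t) else anti (g s) (g t).
Proof.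
move=> gP a_s st; case: eqP => [->|neq]; first by apply: (leg_adj gP); nlia.
by apply: anti_far; rewrite !(leg_lev gP); nlia.
Qed.

Lemma sub_leg g a b a' b' : leg g a b -> a <= a' -> b' <= b -> leg g a' b'.
Proof. by move=> gP ? ? t tP; have [|-> tb] := gP t; [nlia|split=> // ?; apply: tb; nlia]. Qed.

Lemma leg1 v : leg (fun=> v) (lev v) (lev v).
Proof. by move=> t tP; split; nlia. Qed.

Lemma leg_cons g a b y : leg g a.+1 b -> adj y (g a.+1) -> lev y = a ->
  leg (fun t => if t == a then y else g t) a b.
Proof.
move=> gP yg ly t tP; have [->|ne] := eqVneq t a.
  by split=> //; rewrite gtn_eqF.
have [|? gA] := gP t; first nlia.
by split=> // tb; rewrite ifF; [apply: gA|nlia].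
Qed.

Lemma leg_rcons g a b y : a <= b -> leg g a b -> adj (g b) y -> lev y = b.+1 ->
  leg (fun t => if t <= b then g t else y) a b.+1.
Proof.
move=> ab gP gy ly t tP; case: (ltngtP t b) => tb.
- by have [|? gA] := gP t; [nlia|split=> // _; rewrite ?tb; apply: gA].
- by split; [rewrite ly; nlia|nlia].
- by rewrite tb; split=> //; apply: (leg_lev gP); nlia.
Qed.

Lemma exists_leg v : exists2 g, leg g 0 (lev v) & g (lev v) = v.
Proof.
elim: {v}(lev v) {-2}v (erefl (lev v)) => [|k IH] v lv.
  by exists (fun=> v) => //; rewrite -lv; apply: leg1.
have [u uv lu] : exists2 u, adj u v & (lev u).+1 = lev v by apply: lev_parent; nlia.
have [g gP gu] := IH u ltac:(nlia).
exists (fun t => if t <= lev u then g t else v); last by rewrite ifF //; nlia.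
by rewrite -lu; apply: leg_rcons => //; rewrite gu.
Qed.

(** * Bones along one leg *)

Definition twins w c d :=
  [/\ adj w c, adj w d, lev c = (lev w).+1, lev d = (lev w).+1 & anti c d].

(* The pendant vertices at the lower end [g b] are [twins] one layer below it. *)
Lemma leg_bone g a b q q' c d : leg g a b -> a < b -> anti q q' ->
  adj q (g a) -> adj q' (g a) ->
  (forall y, y \in [:: c; d] -> anti q y /\ anti q' y) ->
  (forall t, a < t <= b -> anti q (g t) /\ anti q' (g t)) ->
  twins (g b) c d -> A (b - a).+1.
Proof.
move=> gP ab qq' qa q'a qcd qg [wc wd lc ld cd].
have lb : lev (g b) = b by apply: (leg_lev gP); nlia.
apply: bone_A; first nlia.
pose Q (e i : bool) := if e then if i then c else d else if i then q else q'.
apply: (@contains_bone _ _ (fun t => g (a + t)) Q); first nlia.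
- move=> s t st; have := @leg_induced _ _ _ (a + s) (a + t) gP.
  by rewrite -addnS eqn_add2l; apply; nlia.
- move=> e i t tP; case: e => /=.
    case: eqP => [->|/eqP ne].
      by rewrite subnKC 1?ltnW // adj_sym; case: i.
    by rewrite anti_sym; apply: anti_far; rewrite (leg_lev gP); case: i => /=; nlia.
  case: eqP => [->|ne]; first by rewrite addn0; case: i.
  by have [] : anti q (g (a + t)) /\ anti q' (g (a + t)); [apply: qg; nlia|case: i].
- have Qcd i j : anti (Q false i) (Q true j).
    have [qc q'c] := qcd c (mem_head _ _); have [|qd q'd] := qcd d.
      by rewrite !inE eqxx orbT.
    by case: i; case: j.
  move=> [] i [] j neq.
  + by case: i neq; case: j => //= _; rewrite anti_sym.
  + by rewrite anti_sym.
  + exact: Qcd.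
  + by case: i neq; case: j => //= _; rewrite anti_sym.
Qed.

(** * Bones through two legs *)

Definition clear_of c (g : nat -> G) a b := forall t, a <= t <= b -> anti c (g t).

(** Pendant vertices for a bone that runs up one leg and down the other: each pair avoids the other
    leg and the other pair. *)
Definition separate_ends g a b g' a' b' := exists c d c' d',
  [/\ twins (g b) c d, twins (g' b') c' d',
      clear_of c g' a' b' /\ clear_of d g' a' b',
      clear_of c' g a b /\ clear_of d' g a b &
      [/\ anti c c', anti c d', anti d c' & anti d d']].

Lemma joined_bone g a b g' a' b' : leg g a b -> leg g' a' b' ->
  a <= b -> a' <= b' -> adj (g a) (g' a') ->
  (forall s t, a <= s <= b -> a' <= t <= b' -> (a < s) || (a' < t) -> anti (g s) (g' t)) ->
  separate_ends g a b g' a' b' -> A ((b - a) + (b' - a')).+2.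
Proof.
move=> gP g'P ab ab' gg' cross [c [d [c' [d' [[wc wd lc ld cd] [wc' wd' lc' ld' cd']
  [cg' dg'] [cg dg] [acc' acd' adc' add']]]]]].
have lb : lev (g b) = b by apply: (leg_lev gP); nlia.
have lb' : lev (g' b') = b' by apply: (leg_lev g'P); nlia.
apply: bone_A; first nlia.
pose Q (e i : bool) := if e then if i then c' else d' else if i then c else d.
apply: (@contains_bone _ _
  (fun t => if t <= b - a then g (b - t) else g' (a' + (t - (b - a).+1))) Q); first nlia.
- move=> s t st; case: (leqP t (b - a)) => tP.
    have -> : s <= b - a by nlia.
    have := @leg_induced _ _ _ (b - t) (b - s) gP ltac:(nlia) ltac:(nlia).
    rewrite adj_sym anti_sym.
    by have -> : (b - s == (b - t).+1) = (t == s.+1) by nlia.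
  case: (leqP s (b - a)) => sP.
    case: eqP => [e|ne].
      have -> : b - s = a by nlia.
      by have -> : a' + (t - (b - a).+1) = a' by nlia.
    by apply: cross; nlia.
  have := @leg_induced _ _ _ (a' + (s - (b - a).+1)) (a' + (t - (b - a).+1)) g'P
    ltac:(nlia) ltac:(nlia).
  by have -> : (a' + (t - (b - a).+1) == (a' + (s - (b - a).+1)).+1) = (t == s.+1) by nlia.
- move=> e i t tP; case: e => /=; case: (leqP t (b - a)) => tb.
  + rewrite ifF; last nlia.
    by case: i; [apply: cg|apply: dg]; nlia.
  + case: eqP => [et|ne].
      have -> : a' + (t - (b - a).+1) = b' by nlia.
      by rewrite adj_sym; case: i.
    rewrite anti_sym; apply: anti_far; rewrite (leg_lev g'P); last nlia.
    by case: i => /=; nlia.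
  + case: eqP => [->|ne].
      by rewrite subn0 adj_sym; case: i.
    rewrite anti_sym; apply: anti_far; rewrite (leg_lev gP); last nlia.
    by case: i => /=; nlia.
  + rewrite ifF; last nlia.
    by case: i; [apply: cg'|apply: dg']; nlia.
- by move=> [] [] [] [] //= _; rewrite /Q // anti_sym.
Qed.

Lemma leg_root g b : leg g 0 b -> g 0 = x.
Proof. by move=> gP; apply/eqP; rewrite -lev_eq0 (leg_lev gP). Qed.

(** The child [c] of the lowest vertex ensures that every vertex of the leg below [x], even one in
    layer 1, has a neighbour other than [x] and so is not the leaf [y]. *)
Lemma leg_leaf g b y c t : leg g 0 b -> leaf_of x y -> adj (g b) c -> lev c = b.+1 ->
  0 < t <= b -> anti y (g t).
Proof.
move=> gP yP bc lc tP; have gtx : g t != x.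
  by rewrite -lev_eq0 (leg_lev gP); nlia.
have [tb|tb] := ltnP t b.
  apply: (anti_leaf yP gtx (leg_adj gP _)); first nlia.
  by rewrite -lev_eq0 (leg_lev gP); nlia.
have et : t = b by nlia.
by rewrite et in gtx *; apply: (anti_leaf yP gtx bc); rewrite -lev_eq0 lc.
Qed.

Lemma leg_bone_root g b c d : leg g 0 b -> 0 < b -> twins (g b) c d -> A b.+1.
Proof.
move=> gP b_gt0 cd; have [bc bd lc ld _] := cd.
have lb : lev (g b) = b by apply: (leg_lev gP); nlia.
rewrite -[b in A b.+1]subn0.
apply: (@leg_bone g 0 b l l' c d) => //; rewrite ?(leg_root gP) 1?adj_sym ?xl.1 ?xl'.1 //.
- exact: anti_leaves.
- by move=> y; rewrite !inE => /pred2P[] ->; split; apply: anti_leaf_lev => //; nlia.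
- rewrite lb in lc; move=> t tP.
  by split; [apply: leg_leaf gP xl bc lc tP|apply: leg_leaf gP xl' bc lc tP].
Qed.

Lemma twins_bone v c d : twins v c d -> 0 < lev v -> A (lev v).+1.
Proof.
move=> cd lv; have [g gP gv] := exists_leg v.
by apply: (leg_bone_root gP lv); rewrite gv; apply: cd.
Qed.

(** The bone from the leaves at [x] to the twins has [lev v + 1] path vertices, and [A] contains
    only odd numbers. *)
Lemma twins_even v c d : twins v c d -> ~~ odd (lev v).
Proof.
move=> cd; case: (posnP (lev v)) => [->//|lv].
by have /A_odd := twins_bone cd lv.
Qed.

(** The vertices [g j.+1] and [g' j.+1] are twins below [y], which gives the bone towards [x]. A
    bone from [y] down to one end has as pendants at [y] the top of the other leg and a parent of
    [y], or the leaves at [x] if [j = 0]. The last bone runs through [y] from one end to the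
    other. *)
Lemma junction_bones j g b g' b' y : j < b -> j < b' -> ~~ odd b -> ~~ odd b' ->
  leg g j.+1 b -> leg g' j.+1 b' ->
  (forall s t, j < s <= b -> j < t <= b' -> anti (g s) (g' t)) ->
  separate_ends g j.+1 b g' j.+1 b' -> adj y (g j.+1) -> adj y (g' j.+1) -> lev y = j ->
  [/\ ~~ odd j, j = 0 \/ A j.+1, A (b - j).+1, A (b' - j).+1 &
     A ((b - j) + (b' - j)).+1].
Proof.
move=> jb jb' b_even b'_even.
(* The statement without its fourth conclusion is applied twice, the second time with the legs
   exchanged. *)
wlog suff main : g b g' b' jb jb' b_even b'_even /
  leg g j.+1 b -> leg g' j.+1 b' ->
  (forall s t, j < s <= b -> j < t <= b' -> anti (g s) (g' t)) ->
  separate_ends g j.+1 b g' j.+1 b' -> adj y (g j.+1) -> adj y (g' j.+1) -> lev y = j ->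
  [/\ ~~ odd j, j = 0 \/ A j.+1, A (b - j).+1 & A ((b - j) + (b' - j)).+1].
  move=> gP g'P cross ends yg yg' ly.
  have [? ? ? ?] := main _ _ _ _ jb jb' b_even b'_even gP g'P cross ends yg yg' ly.
  have cross' s t : j < s <= b' -> j < t <= b -> anti (g' s) (g t).
    by move=> sP tP; rewrite anti_sym; apply: cross.
  have ends' : separate_ends g' j.+1 b' g j.+1 b.
    have [c [d [c' [d' [? ? ? ? [? ? ? ?]]]]]] := ends.
    exists c', d', c, d; split=> //.
    by split; rewrite anti_sym.
  by have [] := main _ _ _ _ jb' jb b'_even b_even g'P gP cross' ends' yg' yg ly.
move=> gP g'P cross ends yg yg' ly.
have lg : lev (g j.+1) = j.+1 by apply: (leg_lev gP); nlia.
have lg' : lev (g' j.+1) = j.+1 by apply: (leg_lev g'P); nlia.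
have y_twins : twins y (g j.+1) (g' j.+1).
  by split; rewrite ?ly // cross //; nlia.
have j_even := twins_even y_twins; rewrite ly in j_even.
pose h t := if t == j then y else g t.
have hP : leg h j b by apply: leg_cons.
have hj : h j = y by rewrite /h eqxx.
have hg t : j < t -> h t = g t by move=> jt; rewrite /h ifF //; nlia.
have hb : h b = g b by apply: hg.
have [c [d [c' [d' [cd cd' [cg' dg'] [c'g d'g] [cc' cd0 dc' dd']]]]]] := ends.
have [wc wd lc ld _] := cd; have [wc' wd' lc' ld' _] := cd'.
have lb : lev (g b) = b by apply: (leg_lev gP); nlia.
have lb' : lev (g' b') = b' by apply: (leg_lev g'P); nlia.
split => //.
- case: (posnP j) => [|j_gt0]; [by left|right].
  by have := twins_bone y_twins; rewrite ly; apply.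
- case: (posnP j) => [j0|j_gt0].
    rewrite j0 subn0; apply: (@leg_bone_root h b c d); rewrite ?hb //; last nlia.
    by rewrite -j0.
  have [r yr lr] : exists2 r, adj r y & (lev r).+1 = lev y by apply: lev_parent; nlia.
  apply: (@leg_bone h j b r (g' j.+1) c d); rewrite ?hb ?hj //.
  + by apply: anti_far; nlia.
  + by rewrite adj_sym.
  + by move=> u; rewrite !inE => /pred2P[] ->; split; apply: anti_far; nlia.
  + move=> t tP; rewrite hg; last nlia.
    split; first by apply: anti_far; rewrite (leg_lev gP); nlia.
    by rewrite anti_sym cross; nlia.
- have -> : (b - j + (b' - j)).+1 = (b - j + (b' - j.+1)).+2 by nlia.
  apply: (@joined_bone h j b g' j.+1 b') => //; rewrite ?hj //; first nlia.
    move=> s t sP tP st; have [es|neq] := eqVneq s j.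
      by rewrite es hj; apply: anti_far; rewrite (leg_lev g'P); nlia.
    by rewrite hg; [apply: cross; nlia|nlia].
  exists c, d, c', d'; rewrite hb; split => //.
  by split=> t tP; (have [et|neq] := eqVneq t j;
     [rewrite et hj anti_sym; apply: anti_far; nlia
     |rewrite hg; [apply: c'g || apply: d'g; nlia|nlia]]).
Qed.

Lemma separate_ends_cons j g b g' b' y y' : j < b -> j < b' ->
  leg g j.+1 b -> leg g' j.+1 b' -> lev y = j -> lev y' = j ->
  separate_ends g j.+1 b g' j.+1 b' ->
  separate_ends (fun t => if t == j then y else g t) j b
    (fun t => if t == j then y' else g' t) j b'.
Proof.
move=> jb jb' gP g'P ly ly' [c [d [c' [d' [cd cd' [cg' dg'] [c'g d'g] far]]]]].
have lb : lev (g b) = b by apply: (leg_lev gP); nlia.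
have lb' : lev (g' b') = b' by apply: (leg_lev g'P); nlia.
have eb (z : G) f : (if b == j then z else f b) = f b by rewrite ifF //; nlia.
have eb' (z : G) f : (if b' == j then z else f b') = f b' by rewrite ifF //; nlia.
have [_ _ lc ld _] := cd; have [_ _ lc' ld' _] := cd'.
exists c, d, c', d'; rewrite eb eb'; split => //.
  by split=> t tP; (have [et|ne] := eqVneq t j;
    [rewrite anti_sym; apply: anti_far; nlia|apply: cg' || apply: dg'; nlia]).
by split=> t tP; (have [et|ne] := eqVneq t j;
  [rewrite anti_sym; apply: anti_far; nlia|apply: c'g || apply: d'g; nlia]).
Qed.

(** The legs and the edge between their tops form a bone with [(b - j) + (b' - j) + 2] path
    vertices, an even number because [b] and [b'] are even. *)
Lemma no_crossing j g b g' b' : leg g j b -> leg g' j b' -> j <= b -> j <= b' ->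
  ~~ odd b -> ~~ odd b' -> adj (g j) (g' j) ->
  (forall s t, j <= s <= b -> j <= t <= b' -> (j < s) || (j < t) -> anti (g s) (g' t)) ->
  separate_ends g j b g' j b' -> False.
Proof.
move=> gP g'P jb jb' b_even b'_even gg' cross ends.
by have /A_odd := joined_bone gP g'P jb jb' gg' cross ends; nlia.
Qed.

(** Parents that are each adjacent to the top of only one leg are distinct, and non-adjacent by
    [no_crossing]; so the legs stay apart one layer higher. *)
Lemma legs_extend j g b g' b' y y' : j < b -> j < b' -> ~~ odd b -> ~~ odd b' ->
  leg g j.+1 b -> leg g' j.+1 b' ->
  (forall s t, j < s <= b -> j < t <= b' -> anti (g s) (g' t)) ->
  separate_ends g j.+1 b g' j.+1 b' ->
  adj y (g j.+1) -> adj y' (g' j.+1) -> lev y = j -> lev y' = j ->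
  ~~ adj y (g' j.+1) -> ~~ adj y' (g j.+1) ->
  let h t := if t == j then y else g t in let h' t := if t == j then y' else g' t in
  [/\ leg h j b, leg h' j b',
     forall s t, j <= s <= b -> j <= t <= b' -> anti (h s) (h' t) &
     separate_ends h j b h' j b'].
Proof.
move=> jb jb' b_even b'_even gP g'P cross ends yg y'g' ly ly' yg' y'g h h'.
have lg : lev (g j.+1) = j.+1 by apply: (leg_lev gP); nlia.
have lg' : lev (g' j.+1) = j.+1 by apply: (leg_lev g'P); nlia.
have hP : leg h j b by apply: leg_cons.
have h'P : leg h' j b' by apply: leg_cons.
have endsh : separate_ends h j b h' j b' by apply: separate_ends_cons.
have crossh s t : j <= s <= b -> j <= t <= b' -> (j < s) || (j < t) -> anti (h s) (h' t).
  move=> sP tP st; rewrite /h /h'; have [es|ne] := eqVneq s j.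
    rewrite ifF; last nlia.
    have [->|ne] := eqVneq t j.+1.
      by rewrite /anti yg' andbT; apply/eqP => e; move: lg'; rewrite -e; nlia.
    by apply: anti_far; rewrite (leg_lev g'P); nlia.
  have [et|ne'] := eqVneq t j; last by apply: cross; nlia.
  rewrite anti_sym; have [->|ne''] := eqVneq s j.+1.
    by rewrite /anti y'g andbT; apply/eqP => e; move: lg; rewrite -e; nlia.
  by apply: anti_far; rewrite (leg_lev gP); nlia.
have hj : h j = y by rewrite /h eqxx.
have h'j : h' j = y' by rewrite /h' eqxx.
split=> // s t sP tP.
case: (boolP ((j < s) || (j < t))) => [|njst]; first exact: crossh.
have [-> ->] : s = j /\ t = j by nlia.
rewrite hj h'j /anti; apply/andP; split; first by apply: contraNneq y'g => <-.
apply/negP => yy'; apply: (no_crossing hP h'P) => //; [nlia|nlia|].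
by rewrite hj h'j.
Qed.

(** Both legs are lengthened upwards by parents until a parent of one top is adjacent to the other
    top too. This happens at [x] at the latest, since layer 0 has only one vertex. *)
Lemma legs_meet j g b g' b' : leg g j b -> leg g' j b' -> j <= b -> j <= b' ->
  ~~ odd b -> ~~ odd b' ->
  (forall s t, j <= s <= b -> j <= t <= b' -> anti (g s) (g' t)) ->
  separate_ends g j b g' j b' ->
  exists i, [/\ i < j, ~~ odd i, i = 0 \/ A i.+1, A (b - i).+1 /\ A (b' - i).+1 &
     A ((b - i) + (b' - i)).+1].
Proof.
move=> + + + + b_even b'_even.
elim: j g g' => [|j IH] g g' gP g'P jb jb' cross ends.
  have := cross 0 0 isT isT; rewrite /anti.
  by rewrite (leg_root gP) (leg_root g'P) eqxx.
have lg : lev (g j.+1) = j.+1 by apply: (leg_lev gP); nlia.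
have lg' : lev (g' j.+1) = j.+1 by apply: (leg_lev g'P); nlia.
have [y yg ly] : exists2 y, adj y (g j.+1) & (lev y).+1 = lev (g j.+1).
  by apply: lev_parent; nlia.
have [y' y'g' ly'] : exists2 y, adj y (g' j.+1) & (lev y).+1 = lev (g' j.+1).
  by apply: lev_parent; nlia.
have {}ly : lev y = j by nlia.
have {}ly' : lev y' = j by nlia.
have meet z : adj z (g j.+1) -> adj z (g' j.+1) -> lev z = j ->
    exists i, [/\ i < j.+1, ~~ odd i, i = 0 \/ A i.+1, A (b - i).+1 /\ A (b' - i).+1 &
     A ((b - i) + (b' - i)).+1].
  move=> zg zg' lz; exists j.
  have [] // := junction_bones jb jb' b_even b'_even gP g'P cross ends zg zg' lz.
have [/meet|yg'] := boolP (adj y (g' j.+1)); first exact.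
have [/meet|y'g] := boolP (adj y' (g j.+1)); first exact.
have [hP h'P crossh endsh] := legs_extend jb jb' b_even b'_even gP g'P cross ends
  yg y'g' ly ly' yg' y'g.
have [i [ij *]] := IH _ _ hP h'P (ltnW jb) (ltnW jb') crossh endsh.
by exists i; split=> //; nlia.
Qed.

(* The horizontal edge in layer [j.+1] makes the number of path vertices even. *)
Lemma no_detour h g j i c d : leg h 0 j.+1 -> leg g j.+1 i -> 0 < j -> j.+1 < i ->
  ~~ odd i -> adj (h j.+1) (g j.+1) -> ~~ adj (h j) (g j.+1) -> ~~ adj (h j.+1) (g j.+2) ->
  twins (g i) c d -> False.
Proof.
move=> hP gP j_gt0 ji i_even hg nhg nhg' cd; have [wc wd lc ld acd] := cd.
have li : lev (g i) = i by apply: (leg_lev gP); nlia.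
suff /A_odd : A i.+2 by nlia.
apply: bone_A => //.
pose Q (e b : bool) := if e then if b then c else d else if b then l else l'.
pose p t := if t <= j.+1 then h t else g t.-1.
have lp t : t <= i.+1 -> lev (p t) = if t <= j.+1 then t else t.-1.
  move=> tP; rewrite /p; case: leqP => tj; first by apply: (leg_lev hP); nlia.
  by apply: (leg_lev gP); nlia.
apply: (@contains_bone _ _ p Q) => //.
- move=> s t st; have lps := lp s ltac:(nlia); have lpt := lp t ltac:(nlia).
  case: (leqP t j.+1) => tj; rewrite /p.
    have -> : s <= j.+1 by nlia.
    by rewrite tj; apply: (leg_induced hP); nlia.
  rewrite [t <= _]leqNgt tj /=; case: (leqP s j.+1) => sj.
    case: eqP => [et|net].
      have -> : s = j.+1 by nlia.
      by have -> : t.-1 = j.+1 by nlia.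
    move: lps lpt; rewrite /p sj [t <= _]leqNgt tj /= => lps lpt.
    have [e1|e1] := eqVneq t j.+2.
      have [e2|e2] := eqVneq s j.
        rewrite e2 e1 /= in lps lpt *.
        by rewrite /anti nhg andbT; apply/eqP => e; move: lpt; rewrite -e; nlia.
      by apply: anti_far; nlia.
    have [e3|e3] := eqVneq t j.+3; last by apply: anti_far; nlia.
    have [e2|e2] := eqVneq s j.+1; last by apply: anti_far; nlia.
    rewrite e2 e3 /= in lps lpt *.
    by rewrite /anti nhg' andbT; apply/eqP => e; move: lpt; rewrite -e; nlia.
  have := @leg_induced _ _ _ s.-1 t.-1 gP ltac:(nlia) ltac:(nlia).
  by have -> : (t.-1 == s.-1.+1) = (t == s.+1) by nlia.
- move=> e b t tP; have lpt := lp t tP; case: e => /=.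
    case: eqP => [et|net].
      have nij : (i.+1 <= j.+1) = false by nlia.
      by rewrite /p et nij /= adj_sym; case: b.
    by rewrite anti_sym; apply: anti_far; case: b => /=; move: lpt; case: ifP => ? ?; nlia.
  case: eqP => [->|net].
    by rewrite /p /= (leg_root hP) adj_sym; case: b; [apply: xl.1|apply: xl'.1].
  have [tj|tj] := leqP t j; last first.
    have l1 : 1 < lev (p t) by rewrite lpt; case: ifP; nlia.
    by case: b; apply: anti_leaf_lev.
  have hP' : leg h 0 j by apply: sub_leg hP _ _.
  have hj : adj (h j) (h j.+1) by apply: (leg_adj hP); nlia.
  have lhj : lev (h j.+1) = j.+1 by apply: (leg_lev hP); nlia.
  rewrite /p leqW //.
  by case: b; [apply: (leg_leaf hP' xl hj)|apply: (leg_leaf hP' xl' hj)] => //; nlia.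
- have Qcd b b' : anti (Q false b) (Q true b').
    by case: b; case: b' => /=; apply: anti_leaf_lev => //; nlia.
  move=> [] b [] b' neq.
  + by case: b neq; case: b' => //= _; rewrite anti_sym.
  + by rewrite anti_sym.
  + exact: Qcd.
  + by case: b neq; case: b' => //= _; rewrite ?anti_leaves // anti_sym anti_leaves.
Qed.

(** * Two branching vertices in different layers *)

Definition meet_at i j := exists k, [/\ k < j, ~~ odd k, k = 0 \/ A k.+1,
  A (i - k).+1 /\ A (j - k).+1 & A ((i - k) + (j - k)).+1].

(* In the second alternative the whole of [R] is adjacent to a vertex above [w] and two
   layers below [w']; only this case needs the exclusion of [p + q + 1] from [A]. *)
Lemma branch_pair w c d w' (R : {set G}) :
  twins w c d -> ~~ odd (lev w) -> ~~ odd (lev w') -> 0 < lev w' < lev w ->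
  1 < #|R| -> (forall a, a \in R -> adj w' a /\ lev a = (lev w').+1) ->
  (forall a b, a \in R -> b \in R -> ~~ adj a b) ->
  [\/ A (lev w - lev w').+1, (lev w').+2 < lev w /\ A (lev w - (lev w').+2).+1,
      (lev w').+2 = lev w /\ (forall a, a \in R -> adj w a) | meet_at (lev w) (lev w')].
Proof.
move=> cd; move ei: (lev w) => i; move ej: (lev w') => j.
move=> i_even j_even ji R_gt1 Rw' Rindep.
have [wc wd lc ld acd] := cd; rewrite ei in lc ld.
have [g gP gw] := exists_leg w; rewrite ei in gP gw.
have lg t : t <= i -> lev (g t) = t by move=> tP; apply: (leg_lev gP); nlia.
have gg t : t < i -> adj (g t) (g t.+1) by move=> tP; apply: (leg_adj gP); nlia.
have Ranti a b : a \in R -> b \in R -> a != b -> anti a b.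
  by move=> aR bR ab; rewrite /anti ab Rindep.
have other a : a \in R -> exists2 b, b \in R & anti a b.
  move=> aR; have /card_gt1P[b [b' [bR b'R ne]]] := R_gt1.
  have [ab|nab] := eqVneq a b; first by exists b' => //; apply: Ranti; rewrite // ab.
  by exists b => //; apply: Ranti.
have [a0 [b0 [a0R b0R ab0]]] : exists a b, [/\ a \in R, b \in R & anti a b].
  have /card_gt0P[a aR] : 0 < #|R| by apply: ltnW.
  by have [b bR ab] := other a aR; exists a, b.
have Rfar a t : a \in R -> j.+3 <= t <= i -> anti a (g t).
  by move=> /Rw'[_ la] tP; apply: anti_far; rewrite la lg; nlia.
have Rneq a t : a \in R -> t <= i -> t != j.+1 -> a != g t.
  by move=> /Rw'[_ la] tP; apply: contraNneq => e; rewrite -(lg t tP) -e la.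
have [r rw' lr] : exists2 r, adj r w' & (lev r).+1 = lev w' by apply: lev_parent; nlia.
have gap : j.+2 <= i by nlia.
have li : lev (g i) = i by rewrite lg.
(* This bone starts at [w'], goes on to its child [z] and then follows [g] from layer [j.+2]; the
   pendants at [w'] are its parent [r] and [b]. *)
have from_w' z b : adj w' z -> adj z (g j.+2) -> lev z = j.+1 -> b \in R -> anti b z ->
    ~~ adj b (g j.+2) -> A (i - j).+1.
  move=> w'z ze lz bR bz nbe.
  pose h t := if t == j then w' else if t == j.+1 then z else g t.
  have hP : leg h j i.
    apply: leg_cons => //=; rewrite ?eqxx //.
    by apply: leg_cons => //=; apply: sub_leg gP _ _; nlia.
  have hg t : j.+2 <= t -> h t = g t by move=> tP; rewrite /h !ifF //; nlia.
  have hj : h j = w' by rewrite /h eqxx.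
  have hi : h i = w by rewrite hg.
  apply: (@leg_bone h j i r b c d); rewrite ?hj ?hi //; first nlia.
  - by apply: anti_far; rewrite (Rw' b bR).2; nlia.
  - by rewrite adj_sym (Rw' b bR).1.
  - have lb := (Rw' b bR).2.
    by move=> y; rewrite !inE => /pred2P[] ->; split; apply: anti_far; nlia.
  - move=> t tP; split; first by apply: anti_far; rewrite (leg_lev hP); nlia.
    have [et|ne] := eqVneq t j.+1; first by rewrite /h et eqxx gtn_eqF.
    rewrite hg; last nlia.
    have [et|ne'] := eqVneq t j.+2; last by apply: Rfar => //; nlia.
    by rewrite et /anti nbe Rneq //; nlia.
(* Vertices of [R] can be adjacent to [g] only in layers [j.+2], [j.+1] and [j], which are examined
   in this order. If all of [R] is adjacent to [g j.+2], then either this vertex is [w], or two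
   vertices of [R] are pendants there. *)
have [/exists_inP[a aR ae]|nRe] := boolP [exists a in R, adj a (g j.+2)].
  have [/forall_inP Re|] := boolP [forall b in R, adj b (g j.+2)].
    have [e|ne] := eqVneq j.+2 i.
      by apply: Or43; split=> // b /Re; rewrite e gw adj_sym.
    apply: Or42; split; first nlia.
    apply: (@leg_bone g j.+2 i a0 b0 c d); rewrite ?gw ?Re //.
    - by apply: sub_leg gP _ _.
    - nlia.
    - move=> y ycd; have ly : lev y = i.+1 by move: ycd; rewrite !inE => /pred2P[] ->.
      by split; apply: anti_far; rewrite (Rw' _ _).2 //; nlia.
    - by move=> t tP; split; apply: Rfar.
  rewrite negb_forall_in => /exists_inP[b bR nbe].
  apply: Or41; apply: (from_w' a b) => //; rewrite ?(Rw' a aR).1 ?(Rw' a aR).2 //.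
  by apply: Ranti => //; apply: contraNneq nbe => ->.
have {}nRe a : a \in R -> ~~ adj a (g j.+2).
  by move=> aR; apply: contra nRe => ae; apply/exists_inP; exists a.
have Rc a : a \in R -> a != g j.+1.
  by move=> /nRe; apply: contraNneq => ->; apply: gg; nlia.
have Re a : a \in R -> anti a (g j.+2).
  by move=> aR; rewrite /anti nRe // andbT Rneq //; nlia.
have [w'c|nw'c] := boolP (adj w' (g j.+1)).
  have [/forall_inP Rac|] := boolP [forall b in R, adj b (g j.+1)].
    (* This bone would have [i - j] path vertices, an even number. *)
    have : A (i - j.+1).+1.
      apply: (@leg_bone g j.+1 i a0 b0 c d); rewrite ?gw ?Rac //.
      - by apply: sub_leg gP _ _; nlia.
      - move=> y ycd; have ly : lev y = i.+1 by move: ycd; rewrite !inE => /pred2P[] ->.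
        by split; apply: anti_far; rewrite (Rw' _ _).2 //; nlia.
      - move=> t tP; have [->|ne] := eqVneq t j.+2; first by split; apply: Re.
        by split; apply: Rfar => //; nlia.
    by move/A_odd; nlia.
  rewrite negb_forall_in => /exists_inP[b bR nbc].
  apply: Or41; apply: (from_w' (g j.+1) b) => //; first by apply: gg; nlia.
  - by rewrite lg; nlia.
  - by rewrite /anti nbc Rc.
  - exact: nRe.
(* If [a], but not [w'], is adjacent to [g j.+1], the path from [x] through [w'] and [a], across to
   [g j.+1] and down to [w] contradicts [no_detour]. *)
have [/exists_inP[a aR ac]|nRc] := boolP [exists a in R, adj a (g j.+1)].
  have [h hP hw'] := exists_leg w'; rewrite ej in hP hw'.
  pose h' t := if t <= j then h t else a.
  exfalso; have [w'a la] := Rw' a aR.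
  have h'j : h' j = w' by rewrite /h' leqnn.
  have h'j1 : h' j.+1 = a by rewrite /h' ltnn.
  apply: (@no_detour h' g j i c d); rewrite ?h'j ?h'j1 ?gw ?nRe //; try nlia.
  - by apply: leg_rcons => //; rewrite hw'.
  - by apply: sub_leg gP _ _.
have {}nRc a : a \in R -> anti a (g j.+1).
  move=> aR; rewrite /anti Rc //=; apply: contra nRc => ac.
  by apply/exists_inP; exists a.
have [/exists_inP[a aR af]|nRf] := boolP [exists a in R, adj a (g j)].
  have [q qf lq] : exists2 q, adj q (g j) & (lev q).+1 = lev (g j).
    by apply: lev_parent; rewrite lg; nlia.
  rewrite lg in lq; last nlia.
  have la := (Rw' a aR).2.
  apply: Or41; apply: (@leg_bone g j i q a c d); rewrite ?gw //.
  - by apply: sub_leg gP _ _; nlia.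
  - nlia.
  - by apply: anti_far; nlia.
  - by move=> y; rewrite !inE => /pred2P[] ->; split; apply: anti_far; nlia.
  - move=> t tP; split; first by apply: anti_far; rewrite lg; nlia.
    have [->|ne] := eqVneq t j.+1; first exact: nRc.
    have [->|ne'] := eqVneq t j.+2; first exact: Re.
    by apply: Rfar => //; nlia.
have {}nRf a : a \in R -> anti a (g j).
  move=> aR; rewrite /anti Rneq //=; try nlia; apply: contra nRf => af.
  by apply/exists_inP; exists a.
have gP' : leg g j i by apply: sub_leg gP _ _; nlia.
have w'P : leg (fun=> w') j j by rewrite -ej; apply: leg1.
have nfw' : w' != g j by apply: contraNneq nw'c => ->; apply: gg; nlia.
have cross s t : j < s <= i -> j <= t <= j -> anti (g s) w'.
  move=> sP tP; rewrite anti_sym; have [->|ne] := eqVneq s j.+1.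
    rewrite /anti nw'c andbT; apply/eqP => e.
    by have := lg j.+1 ltac:(nlia); rewrite -e; nlia.
  by apply: anti_far; rewrite lg; nlia.
(* Now [R] has no neighbour on [g] from layer [j] on, so this part of [g] and the single vertex [w']
   are two legs with separate ends, which can be followed upwards until they meet. *)
have ends : separate_ends g j i (fun=> w') j j.
  have Rclear a : a \in R -> clear_of a g j i.
    move=> aR t tP; have [->|ne] := eqVneq t j; first exact: nRf.
    have [->|ne'] := eqVneq t j.+1; first exact: nRc.
    have [->|ne''] := eqVneq t j.+2; first exact: Re.
    by apply: Rfar => //; nlia.
  have la0 := (Rw' a0 a0R).2; have lb0 := (Rw' b0 b0R).2.
  exists c, d, a0, b0; rewrite gw; split => //.
  - by split; rewrite ?la0 ?lb0 ?ej //; [apply: (Rw' a0 a0R).1|apply: (Rw' b0 b0R).1].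
  - by split=> t tP /=; rewrite anti_sym; apply: anti_far; nlia.
  - by split; apply: Rclear.
  - by split; rewrite anti_sym; apply: anti_far; nlia.
have nadj : ~~ adj (g j) w'.
  apply/negP => fw'; apply: (no_crossing gP' w'P) => //; first nlia.
  by move=> s t sP tP st; apply: (cross s t); nlia.
apply: Or44; apply: (legs_meet gP' w'P) => //; first nlia.
move=> s t sP tP; have [->|ne] := eqVneq s j; last by apply: (cross s t); nlia.
by rewrite /anti eq_sym nfw'.
Qed.

(** * Families of vertices in one layer *)

Variable n : nat.
Hypothesis star_n : forall t, contains_induced G (star t) -> t < n.

Lemma indep_nbrs_lt v (I : {set G}) : (forall a, a \in I -> adj v a) ->
  (forall a b, a \in I -> b \in I -> ~~ adj a b) -> #|I| < n.
Proof. by move=> vI indepI; apply/star_n/(@contains_star G v). Qed.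

(** Any two of these legs are as [legs_meet] requires, so a family represents branching vertices in
    layer [i] by ancestors in layer [j]. *)
Definition family (U : {set G}) (g : G -> nat -> G) j i :=
  [/\ forall u, u \in U -> leg (g u) j i /\ g u j = u,
      forall u u', u \in U -> u' \in U -> u != u' ->
        forall s t, j <= s <= i -> j <= t <= i -> anti (g u s) (g u' t) &
      forall u u', u \in U -> u' \in U -> u != u' -> separate_ends (g u) j i (g u') j i].

Lemma family_init (W : {set G}) i : ~~ odd i -> (forall w, w \in W -> lev w = i) ->
  (forall w w', w \in W -> w' \in W -> w != w' ->
     separate_ends (fun=> w) i i (fun=> w') i i) ->
  family W (fun w => fun=> w) i i.
Proof.
move=> i_even lW sepW; have legW w : w \in W -> leg (fun=> w) i i.
  by move=> wW; rewrite -(lW w wW); apply: leg1.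
split=> [w wW|w w' wW w'W ne s t sP tP|//]; first by split=> //; apply: legW.
rewrite /anti ne; apply/negP => ww'.
apply: (no_crossing (legW _ wW) (legW _ w'W)) => //; last exact: sepW.
by move=> ? ? ? ? ?; nlia.
Qed.

Definition parent v := odflt v [pick u | adj u v && ((lev u).+1 == lev v)].

Lemma parentP v : 0 < lev v -> adj (parent v) v /\ (lev (parent v)).+1 = lev v.
Proof.
move=> /lev_parent[u uv lu]; rewrite /parent; case: pickP => [w /andP[-> /eqP]//|].
by move/(_ u); rewrite uv lu eqxx.
Qed.

Lemma card_bigcup_leq (T : finType) (I : finType) (P : pred I) (F : I -> {set T}) :
  #|\bigcup_(i | P i) F i| <= \sum_(i | P i) #|F i|.
Proof.
elim/big_rec2: _ => [|i k B _ le_k]; first by rewrite cards0.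
by apply: leq_trans (leq_card_setU _ _) _; rewrite leq_add2l.
Qed.

(* Climbing two layers: a minimal set of vertices covering the parents of [U] is
   again the set of tops of a family, since each of its members covers some
   parent alone. *)
Lemma family_climb U g j i : ~~ odd j -> j.+2 <= i -> ~~ odd i -> family U g j.+2 i ->
  exists U' g', family U' g' j i /\ #|U| <= #|U'| * (if j == 0 then n - 3 else n - 2).
Proof.
move=> j_even ji i_even [gP gg sepg].
have lU u : u \in U -> lev u = j.+2.
  by case/gP => uP <-; apply: (leg_lev uP); nlia.
have qP u : u \in U -> adj (parent u) u /\ lev (parent u) = j.+1.
  by move=> /lU lu; have [|? ?] := @parentP u; [nlia|split=> //; nlia].
(* Otherwise [u] and [u'] would be twins below a vertex in the odd layer [j.+1]. *)
have qU u u' : u \in U -> u' \in U -> u != u' -> ~~ adj (parent u) u'.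
  move=> uU u'U ne; apply/negP => qu'; have [qu lq] := qP u uU.
  suff : ~~ odd (lev (parent u)) by nlia.
  apply: (@twins_even _ u u'); split; rewrite // ?(lU u uU) ?(lU u' u'U) ?lq //.
  have := gg _ _ uU u'U ne j.+2 j.+2; rewrite (gP _ uU).2 (gP _ u'U).2.
  by apply; nlia.
pose g1 u t := if t == j.+1 then parent u else g u t.
have gj u : u \in U -> g u j.+2 = u by case/gP.
have F1 u u' : u \in U -> u' \in U -> u != u' ->
  [/\ leg (g1 u) j.+1 i, leg (g1 u') j.+1 i,
     forall s t, j.+1 <= s <= i -> j.+1 <= t <= i -> anti (g1 u s) (g1 u' t) &
     separate_ends (g1 u) j.+1 i (g1 u') j.+1 i].
  move=> uU u'U ne; have [[uq lq] [uq' lq']] := (qP u uU, qP u' u'U).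
  apply: legs_extend; rewrite ?gj ?qU //; first exact: (gP u uU).1.
  - exact: (gP u' u'U).1.
  - exact: gg.
  - exact: sepg.
  - by rewrite eq_sym.
have g1P u : u \in U -> leg (g1 u) j.+1 i.
  move=> uU; have [uq lq] := qP u uU; apply: leg_cons => //; last by rewrite gj.
  exact: (gP u uU).1.
pose cov (S : {set G}) := (S \subset [set v | lev v == j]) &&
  [forall u in U, [exists y in S, adj y (parent u)]].
have cov0 : cov [set v | lev v == j].
  apply/andP; split=> //; apply/forall_inP => u /qP[uq lq].
  have [|? ?] := @parentP (parent u); first nlia.
  by apply/exists_inP; exists (parent (parent u)); rewrite ?inE //; nlia.
have [U' /minsetP[/andP[U'lev /forall_inP U'cov] U'min] _] := minset_exists cov0.
have lU' y : y \in U' -> lev y = j by move=> /(subsetP U'lev); rewrite inE => /eqP.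
have priv y : y \in U' -> exists u, [&& u \in U, adj y (parent u) &
    [forall y' in U', adj y' (parent u) ==> (y' == y)]].
  move=> yU'; have : ~~ cov (U' :\ y).
    apply/negP => /U'min; rewrite subD1set => /(_ isT) e.
    by have := setD11 y U'; rewrite e yU'.
  rewrite /cov (subset_trans (subD1set _ _) U'lev) /= negb_forall_in.
  case/exists_inP => u uU; rewrite negb_exists_in => /forall_inP nu.
  have uniq_y y' : y' \in U' -> adj y' (parent u) -> y' == y.
    by move=> y'U' y'u; apply: contraTT y'u => ne; apply: nu; rewrite !inE ne.
  have /exists_inP[y' y'U' y'u] := U'cov u uU.
  exists u; rewrite uU -{1}(eqP (uniq_y y' y'U' y'u)) y'u /=.
  by apply/forall_inP => z zU'; apply/implyP; apply: uniq_y.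
(* Some vertex of [U] whose parent is covered by [y] alone; the new leg of [y] continues through it.
   The default [y] is never taken for [y] in [U']. *)
pose pv y := odflt y [pick u | [&& u \in U, adj y (parent u) &
    [forall y' in U', adj y' (parent u) ==> (y' == y)]]].
have pvP y : y \in U' -> [/\ pv y \in U, adj y (parent (pv y)) &
    forall y', y' \in U' -> adj y' (parent (pv y)) -> y' = y].
  move=> yU'; rewrite /pv; case: pickP => [u /and3P[uU yu /forall_inP uniq_y]|none].
    by split=> // y' /uniq_y/implyP h /h/eqP.
  by have [u] := priv y yU'; rewrite none.
pose g' y t := if t == j then y else g1 (pv y) t.
have g1j u : g1 u j.+1 = parent u by rewrite /g1 eqxx.
exists U', g'; split.
  have F2 y y' : y \in U' -> y' \in U' -> y != y' ->
    [/\ leg (g' y) j i, leg (g' y') j i,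
       forall s t, j <= s <= i -> j <= t <= i -> anti (g' y s) (g' y' t) &
       separate_ends (g' y) j i (g' y') j i].
    move=> yU' y'U' ne; have [uU yu uniq_y] := pvP y yU'.
    have [u'U y'u' uniq_y'] := pvP y' y'U'.
    have neq_u : pv y != pv y'.
      by apply: contra ne => /eqP e; apply/eqP/uniq_y' => //; rewrite -e.
    have [uP u'P cross ends] := F1 _ _ uU u'U neq_u.
    apply: legs_extend; rewrite ?g1j ?lU' //; try nlia.
    - by apply: contra ne => /(uniq_y' y yU')->.
    - by apply: contra ne => /(uniq_y y' y'U')->.
  split=> [y yU'|y y' yU' y'U' ne|y y' yU' y'U' ne].
  - have [uU yu _] := pvP y yU'; split; last by rewrite /g' eqxx.
    by apply: leg_cons; rewrite ?g1j ?lU' //; apply: g1P.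
  - by have [] := F2 y y' yU' y'U' ne.
  - by have [] := F2 y y' yU' y'U' ne.
pose S y := [set u in U | adj y (parent u)].
have sUS : U \subset \bigcup_(y in U') S y.
  apply/subsetP => u uU; have /exists_inP[y yU' yu] := U'cov u uU.
  by apply/bigcupP; exists y; rewrite // inE uU.
apply: leq_trans (subset_leq_card sUS) _.
apply: leq_trans (card_bigcup_leq _ _) _; rewrite -sum_nat_const; apply: leq_sum => y yU'.
have ly := lU' y yU'.
have SU u : u \in S y -> u \in U by rewrite inE => /andP[].
have qS u u' : u \in U -> u' \in U -> ~~ adj (parent u) (parent u').
  move=> uU u'U; have [->|ne] := eqVneq u u'; first by rewrite adj_irrefl.
  have [_ _ /(_ j.+1 j.+1) cross _] := F1 u u' uU u'U ne.
  by move: cross; rewrite !g1j /anti => h; have /andP[] := h ltac:(nlia) ltac:(nlia).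
have card_q : #|[set parent u | u in S y]| = #|S y|.
  apply: card_in_imset => u u' /SU uU /SU u'U e; apply/eqP/negPn/negP => ne.
  by have := qU u u' uU u'U ne; rewrite e (qP u' u'U).1.
(* Independent neighbours of [y] besides the parents it covers: one parent of [y], or the two leaves
   if [y] is [x]. As [y] has fewer than [n] independent neighbours, it covers at most [n - 2], or
   [n - 3], parents. *)
pose E := if j == 0 then [set l; l'] else [set parent y].
have EP e : e \in E -> adj y e /\ forall u, u \in S y -> anti e (parent u).
  rewrite /E; case: eqP => j0.
    have yx : y = x by apply/eqP; rewrite -lev_eq0 ly j0.
    rewrite !inE => /pred2P[]->; (split; first by rewrite yx; (exact: xl.1 || exact: xl'.1));
      move=> u /SU uU; have [uq lq] := qP u uU;
      (apply: (anti_leaf xl _ uq) || apply: (anti_leaf xl' _ uq));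
      by rewrite -lev_eq0 ?lq ?(lU u uU).
  rewrite inE => /eqP->; have [|yp lp] := @parentP y; first nlia.
  rewrite adj_sym; split=> // u /SU /qP[uq lq]; apply: anti_far; nlia.
have EE e e' : e \in E -> e' \in E -> ~~ adj e e'.
  rewrite /E; case: eqP => _; last by rewrite !inE => /eqP-> /eqP->; rewrite adj_irrefl.
  have /andP[_ nll'] := anti_leaves.
  by rewrite !inE => /pred2P[]-> /pred2P[]->; rewrite ?adj_irrefl // adj_sym.
have cardE : #|E| = if j == 0 then 2 else 1.
  by rewrite /E; case: eqP; rewrite ?cards1 // cards2 neq_l.
have : #|[set parent u | u in S y] :|: E| < n.
  apply: (@indep_nbrs_lt y) => [a|a b].
    by case/setUP => [/imsetP[u + ->]|/EP[]//]; rewrite inE => /andP[].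
  case/setUP => [/imsetP[u uS ->]|aE]; case/setUP => [/imsetP[u' u'S ->]|bE].
  - by apply: qS; apply: SU.
  - by rewrite adj_sym; have /andP[] := (EP b bE).2 u uS.
  - by have /andP[] := (EP a aE).2 u' u'S.
  - exact: EE.
rewrite cardsU (_ : _ :&: E = set0).
  by rewrite cards0 subn0 card_q cardE; case: ifP => _; nlia.
apply/setP => z; rewrite !inE; apply/andP => -[/imsetP[u uS ->] /EP[_ /(_ u uS)]].
by rewrite /anti eqxx.
Qed.

(** The family climbs to the root two layers at a time, at a factor [n - 2] each, except for [n - 3]
    in the step into [x]. *)
Lemma family_card_leq h U g i : h.*2 <= i -> ~~ odd i -> family U g h.*2 i ->
  #|U| <= if h == 0 then 1 else (n - 3) * (n - 2) ^ h.-1.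
Proof.
move=> + i_even; elim: h U g => [|h IH] U g hi Ug.
  have lU u : u \in U -> u = x.
    case: Ug => gP _ _ uU; have [uP <-] := gP u uU; exact: (leg_root uP).
  by apply/card_le1P => u uU v; rewrite !inE; apply/idP/eqP => [/lU->|->//]; rewrite (lU u).
have [||U' [g' [U'g' le_U]]] := @family_climb U g h.*2 i _ _ i_even Ug.
- by rewrite odd_double.
- by rewrite -doubleS.
apply: leq_trans le_U _; have := IH _ _ _ U'g'; rewrite double_eq0.
case: h {IH U'g' Ug hi} (ltac:(by rewrite doubleS in hi; nlia) : h.*2 <= i) => [|h] hi /(_ hi) /=.
  by rewrite expn0 muln1 => ?; rewrite -{2}[n - 3]mul1n leq_mul2r; apply/orP; right.
by rewrite expnS => ?; rewrite mulnCA mulnC leq_mul2l; apply/orP; right.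
Qed.

(** * Matching all layers from the deepest one upwards *)

Definition layer_branching (W : {set G}) (R : G -> {set G}) := [/\
  forall w, w \in W -> 1 < #|R w| /\ (forall v, v \in R w -> adj w v /\ lev v = (lev w).+1),
  forall w w' a b, w \in W -> w' \in W -> lev w = lev w' -> a \in R w -> b \in R w' ->
    ~~ adj a b &
  forall w w', w \in W -> w' \in W -> lev w = lev w' -> w != w' ->
    1 < #|R w :\: nbrs w'|].

(** Induction from the deepest layer: [C] collects the vertices of layer [L] used up by the layers
    below, so only those of layer [L.+1] outside their own [C1] enter the next greedy step. *)
Lemma layered_matching L : exists (C W : {set G}) (R : G -> {set G}),
  [/\ C \subset [set v | lev v == L],
     forall w, w \in W -> L <= lev w /\ (lev w = L -> w \in C),
     layer_branching W R &
     missing_at_most ([set v | L < lev v] :|: C) (\sum_(w in W) (#|R w|).-1)].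
Proof.
pose M := \max_(v : G) lev v.
have levM v : lev v <= M by apply: leq_bigmax.
move: {2}(M - L) (leqnn (M - L)) => d; elim: d L => [|d IH] L le_d.
  exists set0, set0, (fun=> set0); split; rewrite ?sub0set //.
  - by move=> w; rewrite in_set0.
  - by split=> [w|w w' a b|w w']; rewrite in_set0.
  - have -> : [set v | L < lev v] :|: set0 = set0.
      by apply/setP => v; rewrite !inE orbF ltnNge (leq_trans (levM v)) //; nlia.
    exact: missing0.
have [|C1 [W1 [R1 [C1L W1L [R1W R1ind R1sep] nm1]]]] := IH L.+1; first nlia.
pose X := [set v | lev v == L.+1] :\: C1; pose P := [set v | lev v == L].
have XL v : v \in X -> lev v = L.+1 by rewrite !inE => /andP[_ /eqP].
have PL v : v \in P -> lev v = L by rewrite inE => /eqP.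
have [||C [W [R [[WC CP] [RW Rind Rsep] RX nm]]]] := @greedy_matching G X P.
- apply/pred0P => v /=; apply/negP => /andP[/XL l1 /PL l2]; nlia.
- move=> v /XL lv; have [|u uv lu] := @lev_parent v; first nlia.
  by exists u; rewrite // inE; apply/eqP; nlia.
have WL w : w \in W -> lev w = L by move=> /(subsetP WC)/(subsetP CP)/PL.
pose R' w := if lev w == L then R w else R1 w.
have R'1 w : w \in W1 -> R' w = R1 w.
  by case/W1L => lw _; rewrite /R' ifF //; nlia.
have R'2 w : w \in W -> R' w = R w by move=> wW; rewrite /R' (WL w wW) eqxx.
exists C, (W1 :|: W), R'; split=> //.
- move=> w /setUP[/W1L[lw _]|wW]; first by split; nlia.
  by rewrite (WL w wW) leqnn; split=> // _; apply: (subsetP WC).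
- split=> [w|w w' a b|w w'].
  + case/setUP => wW; first by rewrite R'1 //; apply: R1W.
    rewrite R'2 //; have [gt1 Rw] := RW w wW; split=> // v vR.
    by split; [apply: Rw|rewrite (XL v) ?(WL w) // (subsetP (RX w wW))].
  + case/setUP => wW; case/setUP => w'W elw.
    * by rewrite (R'1 w wW) (R'1 w' w'W); apply: R1ind.
    * by have [] := W1L w wW; rewrite elw (WL w' w'W) ltnn.
    * by have [] := W1L w' w'W; rewrite -elw (WL w wW) ltnn.
    * by rewrite (R'2 w wW) (R'2 w' w'W); apply: Rind.
  + case/setUP => wW; case/setUP => w'W elw.
    * by rewrite (R'1 w wW); apply: R1sep.
    * by have [] := W1L w wW; rewrite elw (WL w' w'W) ltnn.
    * by have [] := W1L w' w'W; rewrite -elw (WL w wW) ltnn.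
    * by rewrite (R'2 w wW); apply: Rsep.
- have -> : [set v | L < lev v] :|: C = ([set v | L.+1 < lev v] :|: C1) :|: (X :|: C).
    apply/setP => v; rewrite !inE.
    case: (boolP (v \in C1)) => [/(subsetP C1L)|_] /=.
      by rewrite inE => /eqP->; rewrite ltnS leqnn orbT.
    by rewrite orbF orbA; congr (_ || _); nlia.
  have -> : \sum_(w in W1 :|: W) (#|R' w|).-1 =
      \sum_(w in W1) (#|R1 w|).-1 + \sum_(w in W) (#|R w|).-1.
    rewrite (eq_bigl [in [predU W1 & W]]) => [|w]; last by rewrite inE.
    rewrite bigU /=; last first.
      by apply/pred0P => v /=; apply/negP => /andP[/W1L[lv _] /WL]; nlia.
    congr (_ + _); apply: eq_bigr => w wW; first by rewrite R'1.
    by rewrite R'2.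
  apply: missing_union => //; apply/pred0P => v /=; apply/negP => /andP[].
  rewrite !inE => /orP[lv|vC1]; last first.
    by rewrite vC1 /= => /(subsetP CP)/PL; have /eqP := subsetP C1L v vC1; rewrite !inE; nlia.
  by case/orP => [/andP[_ /eqP]|/(subsetP CP)/PL]; nlia.
Qed.

(** * Counting the branching vertices *)

Variable k : nat.
Hypothesis A_sum : forall p q, A p -> A q -> k.*2.+3 <= p -> k.*2.+3 <= q ->
  ~ A (p + q + 1) /\ ~ A (p + q - 1).

(** The hypothesis on [A] for path lengths [d = p - 1] and [e = q - 1] counted in edges. These are
    even, so exceeding [2k] means being at least [2k + 2]. *)
Lemma no_sum d e : A d.+1 -> A e.+1 -> k.*2 < d -> k.*2 < e ->
  ~ A (d + e).+1 /\ ~ A (d + e).+3.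
Proof.
move=> Ad Ae dk ek; have od := A_odd Ad; have oe := A_odd Ae.
have [] := A_sum Ad Ae; [nlia|nlia|].
have -> : d.+1 + e.+1 + 1 = (d + e).+3 by nlia.
by have -> : d.+1 + e.+1 - 1 = (d + e).+1 by nlia.
Qed.

(** Once the family has climbed [2k] layers only one vertex is left: two legs would meet at some
    distance [d > 2k] above layer [i] and give bones of lengths [d], [d] and [2d], against [no_sum].
    Each of the [h] climbs still to be made costs a factor [n - 2]. *)
Lemma family_card_far h U g j i : h <= k -> j + k.*2 = i + h.*2 -> k.*2 < i -> ~~ odd i ->
  family U g j i -> #|U| <= (n - 2) ^ h.
Proof.
move=> hk + ki i_even; elim: h hk U g j => [|h IH] hk U g j jk Ug.
  rewrite expn0 leqNgt; apply/negP => /card_gt1P[u [u' [uU u'U ne]]].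
  have [gP gg sepg] := Ug; have [[uP _] [u'P _]] := (gP u uU, gP u' u'U).
  have ji : j <= i by nlia.
  have [t [tj t_even _ [At _] At2]] :=
    legs_meet uP u'P ji ji i_even i_even (gg u u' uU u'U ne) (sepg u u' uU u'U ne).
  by have [] := no_sum At At; [nlia|nlia|].
have ej : j.-2.+2 = j by nlia.
have [|||U' [g' [U'g' le_U]]] := @family_climb U g j.-2 i _ _ i_even; rewrite ?ej //; try nlia.
apply: leq_trans le_U _; have := IH (ltnW hk) _ _ _ _ U'g'; rewrite expnSr.
have -> : (j.-2 == 0) = false by nlia.
by move=> le_U'; rewrite leq_mul2r le_U' ?orbT //; nlia.
Qed.

Section Branching.

Variables (W : {set G}) (R : G -> {set G}).
Hypothesis WR : layer_branching W R.

Lemma branching_twins w : w \in W ->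
  exists c d, [/\ c \in R w, d \in R w & twins w c d].
Proof.
have [RW Rind _] := WR; move=> wW; have [gt1 Rw] := RW w wW.
have /card_gt1P[c [d [cR dR ne]]] := gt1; exists c, d; split=> //.
have [[wc lc] [wd ld]] := (Rw c cR, Rw d dR).
by split=> //; rewrite /anti ne (Rind w w).
Qed.

Lemma branching_even w : w \in W -> ~~ odd (lev w).
Proof. by move=> /branching_twins[c [d [_ _ /twins_even]]]. Qed.

Lemma branching_bone w : w \in W -> 0 < lev w -> A (lev w).+1.
Proof. by move=> /branching_twins[c [d [_ _ cd]]]; apply: twins_bone cd. Qed.

Lemma branching_separate i w w' : w \in W -> w' \in W -> lev w = i -> lev w' = i ->
  w != w' -> separate_ends (fun=> w) i i (fun=> w') i i.
Proof.
have [RW Rind Rsep] := WR; move=> wW w'W lw lw' ne.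
have elw : lev w = lev w' by rewrite lw.
have /card_gt1P[c [d [cR dR cd]]] := Rsep w w' wW w'W elw ne.
have /card_gt1P[c' [d' [cR' dR' cd']]] := Rsep w' w w'W wW (esym elw) ltac:(by rewrite eq_sym).
move: cR dR cR' dR'; rewrite !inE => /andP[nc cR] /andP[nd dR] /andP[nc' cR'] /andP[nd' dR'].
have RP v a : v \in W -> a \in R v -> adj v a /\ lev a = (lev v).+1.
  by move=> vW; apply: (RW v vW).2.
have [[wc lc] [wd ld]] := (RP _ _ wW cR, RP _ _ wW dR).
have [[wc' lc'] [wd' ld']] := (RP _ _ w'W cR', RP _ _ w'W dR').
have clear v a : lev v = i -> lev a = i.+1 -> ~~ adj v a -> clear_of a (fun=> v) i i.
  move=> lv la va t _; rewrite anti_sym /anti va andbT.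
  by apply/eqP => e; move: la; rewrite -e lv; nlia.
have neq a b : adj w a -> ~~ adj w b -> a != b by move=> wa; apply: contraNneq => <-.
exists c, d, c', d'; split.
- by split=> //; rewrite /anti cd (Rind w w).
- by split=> //; rewrite /anti cd' (Rind w' w').
- by split; apply: clear => //; nlia.
- by split; apply: clear => //; nlia.
- by split; rewrite /anti neq //= (Rind w w').
Qed.

Definition layer i := [set w in W | lev w == i].

Lemma layer_family i : ~~ odd i -> family (layer i) (fun w => fun=> w) i i.
Proof.
move=> i_even; apply: family_init => // [w|w w']; rewrite !inE; first by case/andP => _ /eqP.
by move=> /andP[wW /eqP lw] /andP[w'W /eqP lw']; apply: branching_separate.
Qed.

Lemma layer_card_near h : #|layer h.+1.*2| <= (n - 3) * (n - 2) ^ h.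
Proof.
apply: (@family_card_leq h.+1 _ _ h.+1.*2); rewrite ?odd_double //.
by apply: layer_family; rewrite odd_double.
Qed.

Lemma layer_card_far i : k.*2 < i -> ~~ odd i -> #|layer i| <= (n - 2) ^ k.
Proof. by move=> ki i_even; apply: (family_card_far _ _ ki i_even (layer_family i_even)). Qed.

Lemma branching_pair w w' : w \in W -> w' \in W -> 0 < lev w' < lev w ->
  [\/ A (lev w - lev w').+1, (lev w').+2 < lev w /\ A (lev w - (lev w').+2).+1,
      (lev w').+2 = lev w /\ (forall a, a \in R w' -> adj w a) | meet_at (lev w) (lev w')].
Proof.
have [RW Rind _] := WR; move=> wW w'W lt_lev.
have [c [d [_ _ cd]]] := branching_twins wW; have [gt1 Rw'] := RW w' w'W.
apply: (@branch_pair w c d w' (R w')); rewrite ?branching_even //.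
by move=> a b; apply: Rind.
Qed.

(** Unless the layers differ by two, each outcome of [branching_pair] gives bones of lengths [d],
    [e] and either [d + e] or [d + e + 2], so [d] or [e] is at most [2k]. The first alternative
    arises when the paths meet in a layer at most [2k] and at most [2k] above [w']. *)
Lemma far_branching_gap w w' : w \in W -> w' \in W -> k.*2 < lev w' < lev w ->
  lev w' <= k.*2.*2 \/ lev w <= lev w' + k.*2.+2.
Proof.
move=> wW w'W lt_lev.
have Aw := branching_bone wW ltac:(nlia); have Aw' := branching_bone w'W ltac:(nlia).
case: (branching_pair wW w'W ltac:(nlia)) => [Ad|[gap Ad]|[gap _]|[t [tj _ At [Ai Aj] Aij]]].
- case: (leqP (lev w) (lev w' + k.*2.+2)) => [|far]; first by right.
  have [] := no_sum Aw' Ad; [nlia|nlia|].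
  by have -> : lev w' + (lev w - lev w') = lev w by nlia.
- case: (leqP (lev w) (lev w' + k.*2.+2)) => [|far]; first by right.
  have [] := no_sum Aw' Ad; [nlia|nlia|] => _.
  by have -> : (lev w' + (lev w - (lev w').+2)).+3 = (lev w).+1 by nlia.
- by right; nlia.
- case: At => [t0|At].
    by move: Ai Aj Aij; rewrite t0 !subn0 => Ai Aj; have [] := no_sum Ai Aj; [nlia|nlia|].
  case: (leqP t k.*2) => tk.
    case: (leqP (lev w' - t) k.*2) => tk'; first by left; nlia.
    by have [] := no_sum Ai Aj; [nlia|nlia|].
  case: (leqP (lev w - t) k.*2) => tk'; first by right; nlia.
  have [] := no_sum At Ai tk tk'.
  by have -> : t + (lev w - t) = lev w by nlia.
Qed.

(** For [k = 0] every positive even length falls under [no_sum], which rules out the other three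
    outcomes of [branching_pair]. *)
Lemma branching_gap_k0 w w' : k = 0 -> w \in W -> w' \in W -> 0 < lev w' < lev w ->
  (lev w').+2 = lev w /\ (forall a, a \in R w' -> adj w a).
Proof.
move=> k0 wW w'W lt_lev.
have Aw := branching_bone wW ltac:(nlia); have Aw' := branching_bone w'W ltac:(nlia).
case: (branching_pair wW w'W lt_lev) => [Ad|[gap Ad]|//|[t [tj _ At [Ai Aj] Aij]]].
- have [] := no_sum Aw' Ad; rewrite ?k0; [nlia|nlia|].
  by have -> : lev w' + (lev w - lev w') = lev w by nlia.
- have [] := no_sum Aw' Ad; rewrite ?k0; [nlia|nlia|] => _.
  by have -> : (lev w' + (lev w - (lev w').+2)).+3 = (lev w).+1 by nlia.
- by have [] := no_sum Ai Aj; rewrite ?k0; [nlia|nlia|].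
Qed.

(** A parent of [w] extends [R w] to a larger independent set of neighbours. *)
Lemma branching_card w : w \in W -> 0 < lev w -> #|R w|.+1 < n.
Proof.
have [RW Rind _] := WR; move=> wW lw; have [_ Rw] := RW w wW.
have [pw lp] := parentP lw.
have far v : v \in R w -> anti (parent w) v.
  by move=> /Rw[_ lv]; apply: anti_far; nlia.
have -> : #|R w|.+1 = #|parent w |: R w|.
  rewrite cardsU1 (_ : parent w \notin R w) //.
  by apply/negP => /far; rewrite /anti eqxx.
apply: (@indep_nbrs_lt w) => [a /setU1P[->|/Rw[]//]|a b]; first by rewrite adj_sym.
case/setU1P => [->|aR]; case/setU1P => [->|bR]; rewrite ?adj_irrefl //.
- by have /andP[] := far b bR.
- by rewrite adj_sym; have /andP[] := far a aR.
- exact: (Rind w w).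
Qed.

Lemma far_branching_card :
  #|[set w in W | k.*2 < lev w]| <= k.*2.+2 * (n - 2) ^ k.
Proof.
set Wf := [set w in W | _]; have WfP w : w \in Wf -> w \in W /\ k.*2 < lev w.
  by rewrite inE => /andP.
have [->|[w0 w0W]] := set_0Vmem Wf; first by rewrite cards0.
have [w wW maxw] : exists2 w, w \in Wf & forall v, v \in Wf -> lev v <= lev w.
  by case: (@arg_maxnP _ w0 [in Wf] lev w0W) => w wW maxw; exists w.
have [wW' lw] := WfP w wW.
(* [inl] indexes the [k] even layers from [2k + 2] to [4k], and [inr] the [k + 2] even layers within
   [2k + 2] of the deepest one. *)
pose F (h : 'I_k + 'I_k.+2) := match h with
  | inl h => [set v in Wf | lev v == (k.+1 + h).*2]
  | inr h => [set v in Wf | lev v == lev w - h.*2] end.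
have WF : Wf \subset \bigcup_(h in predT) F h.
  apply/subsetP => v vWf; have [vW lv] := WfP v vWf.
  have v_even := branching_even vW; have w_even := branching_even wW'.
  have le_vw := maxw v vWf; apply/bigcupP.
  suff [le_v|le_w] : lev v <= k.*2.*2 \/ lev w <= lev v + k.*2.+2.
  - have hk : (lev v)./2 - k.+1 < k by nlia.
    by exists (inl (Ordinal hk)); rewrite // inE vWf /=; apply/eqP; nlia.
  - have hk : (lev w - lev v)./2 < k.+2 by nlia.
    by exists (inr (Ordinal hk)); rewrite // inE vWf /=; apply/eqP; nlia.
  have [e|ne] := eqVneq (lev v) (lev w); first by right; nlia.
  by apply: far_branching_gap => //; nlia.
have Flayer i (B : {set G}) : B = [set v in Wf | lev v == i] -> #|B| <= (n - 2) ^ k.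
  move=> ->; have [->|[v]] := set_0Vmem [set v in Wf | lev v == i]; first by rewrite cards0.
  rewrite inE => /andP[/WfP[vW lv] /eqP ei].
  have i_even : ~~ odd i by rewrite -ei branching_even.
  apply: leq_trans (layer_card_far _ i_even); last nlia.
  by apply: subset_leq_card; apply/subsetP => u; rewrite !inE => /andP[/andP[-> _]].
apply: leq_trans (subset_leq_card WF) _; apply: leq_trans (card_bigcup_leq _ _) _.
have -> : k.*2.+2 = #|{: 'I_k + 'I_k.+2}| by rewrite card_sum !card_ord; nlia.
rewrite -sum_nat_const; apply: leq_sum => -[h|h] _; exact: Flayer.
Qed.

Lemma branching_total : 3 < n -> #|[set w in W | 0 < lev w]| < k.*2.+3 * (n - 2) ^ k.
Proof.
move=> n_gt3; pose near h := layer h.+1.*2.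
have cover : [set w in W | 0 < lev w] \subset
    \bigcup_(h < k) near h :|: [set w in W | k.*2 < lev w].
  apply/subsetP => w; rewrite inE => /andP[wW lw]; have w_even := branching_even wW.
  apply/setUP; case: (leqP (lev w) k.*2) => lk; last by right; rewrite inE wW.
  have hk : (lev w)./2.-1 < k by nlia.
  left; apply/bigcupP; exists (Ordinal hk) => //; rewrite inE wW /=; apply/eqP; nlia.
(* The sum of [(n - 3)(n - 2)^h] over [h < k] is [(n - 2)^k - 1]; the spare one makes the total
   strict and so leaves room for [x]. *)
have le_near : (\sum_(h < k) #|near h|).+1 <= (n - 2) ^ k.
  elim: (k) => [|h IH]; first by rewrite big_ord0 expn0.
  have n2 : n - 2 = (n - 3).+1 by nlia.
  by rewrite big_ord_recr /= -addSn expnS [X in X * _]n2 mulSn leq_add ?layer_card_near.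
have le_far := far_branching_card.
apply: (@leq_ltn_trans (\sum_(h < k) #|near h| + #|[set w in W | k.*2 < lev w]|)).
  apply: leq_trans (subset_leq_card cover) _; apply: leq_trans (leq_card_setU _ _) _.
  by rewrite leq_add2r card_bigcup_leq.
by rewrite mulSn -addSn leq_add.
Qed.

(** Each layer below [x] has at most one branching vertex, and those other than the deepest one [w]
    lie two layers above it, so there is at most one other, [v]. As [R v] and [R w] together are
    independent neighbours of [w], their sizes add up to less than [n]. *)
Lemma branching_sum_k0 : 3 < n -> k = 0 ->
  \sum_(w in W | 0 < lev w) (#|R w|).-1 <= n - 3.
Proof.
have [RW Rind _] := WR; move=> n_gt3 k0.
rewrite (eq_bigl [in [set w in W | 0 < lev w]]) => [|w]; last by rewrite inE.
set Wp := [set w in W | _]; have WpP w : w \in Wp -> w \in W /\ 0 < lev w.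
  by rewrite inE => /andP.
have [->|[w0 w0W]] := set_0Vmem Wp; first by rewrite big_set0.
have [w wWp maxw] : exists2 w, w \in Wp & forall v, v \in Wp -> lev v <= lev w.
  by case: (@arg_maxnP _ w0 [in Wp] lev w0W) => w wW maxw; exists w.
have [wW lw] := WpP w wWp.
have same u v : u \in Wp -> v \in Wp -> lev u = lev v -> u = v.
  move=> /WpP[uW lu] /WpP[vW lv] e.
  have /card_le1_eqP : #|layer (lev u)| <= 1.
    by have := @layer_card_far (lev u); rewrite k0 expn0; apply=> //; apply: branching_even.
  by apply; rewrite !inE ?uW ?vW ?e eqxx.
have below v : v \in Wp -> v != w ->
    (lev v).+2 = lev w /\ (forall a, a \in R v -> adj w a).
  move=> vWp ne; have [vW lv] := WpP v vWp; have le_vw := maxw v vWp.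
  have [e|ne'] := eqVneq (lev v) (lev w); first by rewrite (same v w) ?eqxx in ne.
  by apply: branching_gap_k0 => //; nlia.
rewrite (big_setD1 w) //=.
have [->|[v]] := set_0Vmem (Wp :\ w).
  by rewrite big_set0 addn0; have := branching_card wW lw; nlia.
rewrite !inE => /and3P[ne vW lv]; have vWp : v \in Wp by rewrite inE vW.
have -> : Wp :\ w = [set v].
  apply/setP => u; rewrite !in_setD1 in_set1; apply/andP/eqP => [[neu uWp]|->//].
  by apply: same => //; have [+ _] := below v vWp ne; have [+ _] := below u uWp neu; nlia.
rewrite big_set1; have [gap wv] := below v vWp ne.
have [[Rw_gt1 Rw] [Rv_gt1 Rv]] := (RW w wW, RW v vW).
have far a b : a \in R v -> b \in R w -> anti a b.
  by move=> /Rv[_ la] /Rw[_ lb]; apply: anti_far; nlia.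
have : #|R w :|: R v| < n.
  apply: (@indep_nbrs_lt w) => [a /setUP[/Rw[]//|/wv//]|a b].
  case/setUP => aR; case/setUP => bR.
  - exact: (Rind w w).
  - by rewrite adj_sym; have /andP[] := far b a bR aR.
  - by have /andP[] := far a b aR bR.
  - exact: (Rind v v).
rewrite cardsU (_ : R w :&: R v = set0); first by rewrite cards0; move: Rw_gt1 Rv_gt1; clear; lia.
apply/setP => a; rewrite !inE; apply/andP => -[aw av].
by have := far a a av aw; rewrite /anti eqxx.
Qed.

Lemma branching_sum : 3 < n ->
  \sum_(w in W | 0 < lev w) (#|R w|).-1 + (n - 3) <= k.*2.+3 * (n - 3) * (n - 2) ^ k.
Proof.
move=> n_gt3.
rewrite (eq_bigl [in [set w in W | 0 < lev w]]) => [|w]; last by rewrite inE.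
apply: (@leq_trans (#|[set w in W | 0 < lev w]| * (n - 3) + (n - 3))).
  rewrite leq_add2r -sum_nat_const; apply: leq_sum => w; rewrite inE => /andP[wW lw].
  by have := branching_card wW lw; nlia.
by rewrite addnC -mulSn -mulnAC leq_mul2r branching_total ?orbT.
Qed.

End Branching.

(** The root costs at most [n - 2]: it may be branching, with fewer than [n] vertices in [R x], or
    be a single unmatched vertex. In the first bound [branching_sum] absorbs [n - 3] of this and the
    final 1 is the rest; for [k = 0] it is added to [n - 3]. *)
Lemma layered_bound : 3 < n ->
  missing_at_most [set: G] (k.*2.+3 * (n - 3) * (n - 2) ^ k + 1) /\
  (k = 0 -> missing_at_most [set: G] (2 * n - 5)).
Proof.
move=> n_gt3; have [C [W [R [Cx Wlev WR nm]]]] := layered_matching 0.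
have Cx' v : v \in C -> v = x.
  by move=> /(subsetP Cx); rewrite inE lev_eq0 => /eqP.
suff main : missing_at_most [set: G] (\sum_(w in W | 0 < lev w) (#|R w|).-1 + (n - 2)).
  split=> [|k0]; apply: missing_leq main _.
    by have := branching_sum WR n_gt3; nlia.
  by have := branching_sum_k0 WR n_gt3 k0; nlia.
have eqW : \sum_(w in W) (#|R w|).-1 <= \sum_(w in W | 0 < lev w) (#|R w|).-1 +
    (if x \in W then n - 2 else 0).
  rewrite (bigID (fun w => 0 < lev w)) /= leq_add2l.
  have small w : w \in W -> ~~ (0 < lev w) -> w = x.
    by move=> _; rewrite lt0n negbK lev_eq0 => /eqP.
  case: ifP => [xW|/negbT xW]; last first.
    rewrite big_pred0 // => w; apply/negP => /andP[wW lw].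
    by rewrite -(small w wW lw) wW in xW.
  rewrite (eq_bigl (pred1 x)) => [|w]; last first.
    apply/andP/eqP => [[wW lw]|->]; first exact: small.
    by rewrite lev_root.
  rewrite big_pred1_eq; have [RW Rind _] := WR; have [_ Rx] := RW x xW.
  have : #|R x| < n by apply: (@indep_nbrs_lt x) => [a /Rx[]|a b]; [|apply: Rind].
  nlia.
have [xC|xC] := boolP (x \in C).
  have -> : [set: G] = [set v | 0 < lev v] :|: C.
    apply/setP => v; rewrite !inE lt0n lev_eq0.
    by have [->|] := eqVneq v x; rewrite ?xC.
  apply: missing_leq nm _; apply: leq_trans eqW _; rewrite leq_add2l.
  by case: ifP.
have xW : x \notin W.
  by apply: contra xC => /Wlev[_]; rewrite lev_root; apply.
have -> : [set: G] = x |: ([set v | 0 < lev v] :|: C).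
  apply/setP => v; rewrite !inE lt0n lev_eq0.
  by case: eqVneq.
rewrite (negbTE xW) addn0 in eqW.
apply: (@missing_leq _ _ (\sum_(w in W) (#|R w|).-1).+1); last first.
  by rewrite -addn1; apply: leq_add => //; nlia.
by apply: missing_vertex; rewrite // !inE lev_root (negbTE xC).
Qed.

End Layered.

(** * Reduction to graphs with two leaves at one vertex *)

(** The hypotheses pass to connected induced subgraphs and the bounds do not depend on [G], so an
    edge whose removal leaves a connected graph can be matched and dropped. Without such an edge,
    [exists_two_leaves] supplies the root of the layers. *)
Lemma connected_missing (k n : nat) (A : nat -> Prop) : 3 < n ->
  (forall i, A i -> odd i) ->
  (forall p q, A p -> A q -> k.*2.+3 <= p -> k.*2.+3 <= q ->
     ~ A (p + q + 1) /\ ~ A (p + q - 1)) ->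
  forall G : sgraph, connected G ->
  (forall t, contains_induced G (star t) -> t < n) ->
  (forall i, 2 <= i -> contains_induced G (bone i) -> A i) ->
  missing_at_most [set: G] (k.*2.+3 * (n - 3) * (n - 2) ^ k + 1) /\
  (k = 0 -> missing_at_most [set: G] (2 * n - 5)).
Proof.
move=> n_gt3 A_odd A_sum G; move: {2}_.+1 (ltnSn #|G|) => N.
elim: N G => // N IH G ltG [G_gt0 G_conn] star_n bone_A.
pose outside (u v : G) := ~: [set u; v].
have [/existsP[u /existsP[v /andP[uv /forallP conn_uv]]]|irr] := boolP [exists u : G,
    [exists v, adj u v && [forall z in outside u v, [forall z' in outside u v,
    connect (adj_in (outside u v)) z z']]]].
  have {}conn_uv z z' : z \in outside u v -> z' \in outside u v ->
      connect (adj_in (outside u v)) z z'.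
    by move=> zB; have /implyP/(_ zB)/forall_inP := conn_uv z; apply.
  have extend b : missing_at_most (outside u v) b -> missing_at_most [set: G] b.
    move=> nm; have -> : [set: G] = u |: (v |: outside u v).
      by apply/setP => z; rewrite !inE; case: (z == u); case: (z == v).
    by apply: missing_edge; rewrite // !inE ?eqxx ?orbT.
  have [e|[z zB]] := set_0Vmem (outside u v).
    by split=> [|_]; apply: extend; rewrite e; apply: missing0.
  have [||t Gt|i i_ge2 Gi|nm nm0] := IH (induced (outside u v)).
  - rewrite card_induced /outside; have := cardsC [set u; v].
    by rewrite cards2 (adj_neq uv); move: ltG; clear; lia.
  - split; first by rewrite card_induced; apply/card_gt0P; exists z.
    by move=> a b; apply: induced_connect; apply: conn_uv; apply: valP.
  - exact: star_n (contains_induced_induced Gt).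
  - exact: bone_A i_ge2 (contains_induced_induced Gi).
  - split=> [|k0]; apply: extend.
      by have := missing_induced nm; rewrite imset_val_induced.
    by have := missing_induced (nm0 k0); rewrite imset_val_induced.
have {}irr u v : adj u v -> exists z z', [/\ z \in outside u v, z' \in outside u v &
    ~~ connect (adj_in (outside u v)) z z'].
  move=> uv; move: irr; rewrite negb_exists => /forallP/(_ u).
  rewrite negb_exists => /forallP/(_ v); rewrite uv /= negb_forall_in.
  case/exists_inP => z zB; rewrite negb_forall_in => /exists_inP[z' z'B nzz'].
  by exists z, z'.
have [G_gt1|G_le1] := ltnP 1 #|G|.
  have [x [l [l' [xl xl' ne]]]] := exists_two_leaves G_conn G_gt1 irr.
  have [lev [lev_eq0 lev_adj lev_parent]] := exists_layers G_conn x.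
  exact: (layered_bound lev_eq0 lev_adj lev_parent xl xl' ne bone_A A_odd star_n A_sum).
have nm1 : missing_at_most [set: G] 1.
  by apply: missing_leq (missing_card _) _; rewrite cardsT.
by split=> [|_]; apply: missing_leq nm1 _; [rewrite addn1|lia].
Qed.

Theorem theorem1p4 (m : nat) (A : nat -> Prop)
    (m_ge3 : 3 <= m) (m_odd : odd m)
    (A_odd : forall i, A i -> 2 <= i /\ odd i)
    (A_sum : forall p q, A p -> A q -> m <= p -> m <= q ->
       ~ A (p + q + 1) /\ ~ A (p + q - 1))
    (n : nat) (n_gt3 : 3 < n)
    (G : sgraph) (G_family : bone_family A G) (G_alpha : alpha_l G < n) :
  deficiency G <= m * (n - 3) * (n - 2) ^ ((m - 3) %/ 2) + 1 /\
  (m = 3 -> deficiency G <= 2 * n - 5).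
Proof.
have [G_conn bone_A] := G_family.
have [k mk] : exists k, m = k.*2.+3 by exists (m - 3)./2; lia.
have star_n t : contains_induced G (star t) -> t < n.
  by move=> /leq_alpha_l le_t; apply: leq_ltn_trans le_t G_alpha.
have -> : (m - 3) %/ 2 = k by lia.
rewrite mk in A_sum *.
have [nm nm0] := connected_missing n_gt3 (fun i Ai => (A_odd i Ai).2) A_sum G_conn star_n bone_A.
by split=> [|k0]; apply: deficiency_leq; [|apply: nm0; lia].
Qed.
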